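(* Let $k,n$ be positive integers with $k\ge n+1$, $n\ge2$, and $a,a_1,\ldots,a_{n-1}\in R$, and set $a_0:=0$. Then $$\sum_{\substack{k_1+\cdots+k_n=k\\ k_j\ge1,\,k_1\ge2}}L_\ast(k_1,\ldots,k_n;\,a,\,a_1-a,\,a_2-a_1,\ldots,a_{n-1}-a_{n-2})$$ $$+\sum_{i=2}^{n-1}\sum_{\substack{k_1+\cdots+k_n=k\\ k_j\ge1,\,k_1\ge2}}L_\ast(k_1,\ldots,k_n;\,a_1,a_2-a_1,\ldots,a_{i-1}-a_{i-2},\,a-a_{i-1},\,a_i-a,\,a_{i+1}-a_i,\ldots,a_{n-1}-a_{n-2})$$ $$+\sum_{\substack{k_1+\cdots+k_n=k\\ k_j\ge1,\,k_1\ge2,\,k_n=1}}L_\ast(k_1,\ldots,k_n;\,a_1,a_2-a_1,\ldots,a_{n-1}-a_{n-2},\,a-a_{n-1})$$ $$=\sum_{\substack{k_1+\cdots+k_n=k\\ k_j\ge1,\,k_1=1,\,k_2\ge2}}\mathcal{L}_\ast\Big(z_{k_1,a}z_{k_2,a_1}z_{k_3,a_2-a_1}\cdots z_{k_n,a_{n-1}-a_{n-2}}-z_{k_1,a}z_{k_2,a_1-a}z_{k_3,a_2-a_1}\cdots z_{k_n,a_{n-1}-a_{n-2}}\Big)$$ $$+\sum_{i=2}^{n}\sum_{\substack{k_1+\cdots+k_n=k\\ k_j\ge1,\,k_1\ge2,\,k_i=1}}L_\ast(k_1,\ldots,k_n;\,a_1,a_2-a_1,\ldots,a_{i-1}-a_{i-2},\,a,\,a_i-a_{i-1},\ldots,a_{n-1}-a_{n-2})$$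 $$+\sum_{\substack{k_1+\cdots+k_{n-1}=k\\ k_j\ge1,\,k_1\ge3}}L_\ast(k_1,\ldots,k_{n-1};\,a+a_1,\,a_2-a_1,\ldots,a_{n-1}-a_{n-2})$$ $$+\sum_{i=2}^{n-1}\sum_{\substack{k_1+\cdots+k_{n-1}=k\\ k_j\ge1,\,k_1,k_i\ge2}}L_\ast(k_1,\ldots,k_{n-1};\,a_1,a_2-a_1,\ldots,a_{i-1}-a_{i-2},\,a+a_i-a_{i-1},\,a_{i+1}-a_i,\ldots,a_{n-1}-a_{n-2}).$$ (In each index list, the initial segment $a_1,a_2-a_1,\ldots,a_{i-1}-a_{i-2}$ is just $a_1$ when $i=2$.)
   Context: Fix $N\ge1$, $R=\mathbb{Z}/N\mathbb{Z}$, $\omega=\exp(2\pi i/N)$. For positive integers $k_1,\ldots,k_n$ and $a_1,\ldots,a_n\in R$, $L_\ast(k_1,\ldots,k_n;a_1,\ldots,a_n)=\sum_{m_1>\cdots>m_n>0}\omega^{a_1m_1+\cdots+a_nm_n}/(m_1^{k_1}\cdots m_n^{k_n})$, convergent when $k_1\ge2$ or ($k_1=1$ and $a_1\ne0$). Let $\mathcal{A}=\mathbb{Q}\langle x,y_a\mid a\in R\rangle$, $z_{k,a}=x^{k-1}y_a$, and $\mathcal{A}^0=\mathbb{Q}+\sum_{a\in R}x\mathcal{A}y_a+\sum_{a,b\in R,\,b\ne0}y_b\mathcal{A}y_a$. The $\mathbb{Q}$-linear map $\mathcal{L}_\ast:\mathcal{A}^0\to\mathbb{C}$ sends $z_{k_1,a_1}\cdots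 z_{k_n,a_n}$ to $L_\ast(k_1,\ldots,k_n;a_1,\ldots,a_n)$. In the first sum on the right, the argument of $\mathcal{L}_\ast$ lies in $\mathcal{A}^0$ (it is the zero element when $a=0$). *)

(* Defs.v *)
(* monalg is imported without its notations, which clash with mathcomp-analysis. *)
From HB Require Import structures.
From mathcomp Require Import all_boot all_order all_algebra.
From mathcomp Require Export complex.
From mathcomp.multinomials Require monalg.
From mathcomp Require Import all_classical all_reals all_analysis.
Export -(notations) monalg.
Export numFieldNormedType.Exports.

Set Implicit Arguments.
Unset Strict Implicit.
Unset Printing Implicit Defensive.

Import Order.TTheory GRing.Theory Num.Theory.
Local Open Scope classical_set_scope.
Local Open Scope ring_scope.

(* The complex numbers, typed as a numClosedFieldType so that the topology of
   numFieldNormedType (given by the modulus) is found on them. *)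
Definition Cplx (R : realType) : numClosedFieldType := R[i].

(* Z/NZ for N >= 1. Not 'Z_N, because 'Z_1 is Z/2Z; 'I_1 is the zero group. *)
Notation ZmodN N := 'I_N.-1.+1.

Section Lvalues.
Variables (R : realType) (N : nat).

Definition omega : Cplx R :=
  (cos (2 * pi / N%:R) +i* sin (2 * pi / N%:R))%C.

(* The partial sum over M > m_1 > ... > m_n > 0, with n = size ks. An element
   of Z/NZ is used in the exponent through its representative in 0..N-1, which
   is harmless since omega ^+ N = 1. *)
Definition Lstar_trunc (ks : seq nat) (as_ : seq (ZmodN N)) (M : nat) : Cplx R :=
  \sum_(m : {ffun 'I_(size ks) -> 'I_M} |
        [forall j, (0 < m j)%N] &&
        [forall i : 'I_(size ks), forall j : 'I_(size ks),
           (i < j)%N ==> (m j < m i)%N])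
    omega ^+ (\sum_(j < size ks) nth 0%R as_ j * m j)%N
      / \prod_(j < size ks) (m j)%:R ^+ nth 0%N ks j.

(* The series is only conditionally convergent when k_1 = 1 and a_1 != 0; it is
   summed, as usual, by letting the bound on the largest index m_1 grow. *)
Definition Lstar (ks : seq nat) (as_ : seq (ZmodN N)) : Cplx R :=
  lim (Lstar_trunc ks as_ @ \oo).

End Lvalues.

Section Words.
Variable N : nat.

(* None is the letter x and Some a is the letter y_a. *)
Definition letter : choiceType := option (ZmodN N).

Definition Aalg := malg (fmonom letter) rat.

Definition xA : Aalg := mkmalgU (fmu None) 1.
Definition yA (a : ZmodN N) : Aalg := mkmalgU (fmu (Some a)) 1.
Definition zA (k : nat) (a : ZmodN N) : Aalg := xA ^+ k.-1 * yA a.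

Definition zprod (ks : seq nat) (as_ : seq (ZmodN N)) : Aalg :=
  \prod_(p <- zip ks as_) zA p.1 p.2.

Definition A0 : set Aalg := [set w | exists (c : rat) (u : ZmodN N -> Aalg)
    (v : ZmodN N -> ZmodN N -> Aalg),
  w = c%:A + \sum_a xA * u a * yA a
      + \sum_a \sum_(b | b != 0) yA b * v a b * yA a].

(* Reads x^(k_1-1) y_(a_1) ... x^(k_n-1) y_(a_n) as (k_1,a_1) ... (k_n,a_n); k is
   one more than the number of x just read. Final x's are dropped, which does
   not concern the words of A0. *)
Fixpoint zparse (k : nat) (w : seq letter) : seq (nat * ZmodN N) :=
  match w with
  | [::] => [::]
  | None :: w' => zparse k.+1 w'
  | Some a :: w' => (k, a) :: zparse 1 w'
  end.

(* The map is given on all words by the same formula, so only its values on A0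
   are meaningful; see calL_linear, calL_zprod and A0_zprodB below. *)
Definition calL (R : realType) (w : Aalg) : Cplx R :=
  mmap (ratr : rat -> Cplx R)
    (fun m : fmonom letter =>
       Lstar R (unzip1 (zparse 1 m)) (unzip2 (zparse 1 m))) w.

End Words.

Section Compositions.

Definition compositions (n k : nat) : seq (seq nat) :=
  [seq ks <- [seq map val (tval t) | t : n.-tuple 'I_k.+1]
     | all (leq 1) ks && (sumn ks == k)].

(* The entry k_j, numbered from 1. *)
Definition part (ks : seq nat) (j : nat) : nat := nth 0%N ks j.-1.

(* The list a_p - a_(p-1), ..., a_q - a_(q-1), empty when q < p. *)
Definition diffs (V : zmodType) (al : nat -> V) (p q : nat) : seq V :=
  [seq al j - al j.-1 | j <- index_iota p q.+1].

End Compositions.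

Section Facts.

Lemma mem_compositions n k ks :
  (ks \in compositions n k) = [&& size ks == n, all (leq 1) ks & sumn ks == k].
Proof.
rewrite mem_filter andbC; apply/andP/and3P => [[/mapP[t _ ->] /andP[-> ->]]|].
  by rewrite size_map size_tuple.
case=> /eqP sn al sk; split; last by rewrite al.
have lek : all (fun i => i < k.+1)%N ks.
  apply/allP => i iks; rewrite ltnS -(eqP sk) sumnE (big_rem i iks) /=.
  exact: leq_addr.
have sz : size (map (inord : nat -> 'I_k.+1) ks) == n by rewrite size_map sn.
apply/mapP; exists (Tuple sz); rewrite ?mem_enum//=.
rewrite -map_comp -[LHS]map_id; apply/eq_in_map => i /(allP lek) ik /=.
by rewrite inordK.
Qed.

Lemma compositions_uniq n k : uniq (compositions n k).
Proof.
apply: filter_uniq; rewrite map_inj_in_uniq ?enum_uniq// => s t _ _ /=.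
by move/(inj_map val_inj)/val_inj.
Qed.

Lemma calL_linear (R : realType) N (c : rat) (u v : Aalg N) :
  calL R (c *: u + v) = ratr c * calL R u + calL R v.
Proof.
rewrite /calL mmapD; congr (_ + _).
rewrite (mmapEw (msuppZ_le _ _)) mmapE big_distrr /=.
apply/eq_bigr => m _; rewrite mcoeffZ rmorphM; exact/esym/mulrA.
Qed.

Lemma zA_monom N k a :
  zA k a = mkmalgU (FMonom (rcons (nseq k.-1 None) (Some a))) 1 :> Aalg N.
Proof.
rewrite /zA; elim: k.-1 => [|i ih]; first by rewrite expr0 mul1r /= /yA fmuE.
rewrite exprS -mulrA ih /xA malgM_def fgmulUU mulr1 /=; congr mkmalgU.
by rewrite /mul/= fmmulE fmuE.
Qed.

Lemma zprod_monom N ks as_ : @zprod N ks as_ =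
  mkmalgU (FMonom (flatten
    [seq rcons (nseq p.1.-1 None) (Some p.2) | p <- zip ks as_])) 1.
Proof.
rewrite /zprod; elim: (zip _ _) => [|p s ih]; first by rewrite big_nil -fmoneE.
rewrite big_cons ih zA_monom malgM_def fgmulUU mulr1; congr mkmalgU.
by rewrite /mul/= fmmulE.
Qed.

Lemma calL_zprod (R : realType) N ks (as_ : seq (ZmodN N)) :
  size as_ = size ks -> all (leq 1) ks ->
  calL R (zprod ks as_) = Lstar R ks as_.
Proof.
move=> sz pos; rewrite /calL zprod_monom mmapU /=.
rewrite (rmorph1 (ratr : {rmorphism rat -> Cplx R})) mul1r.
have -> : zparse 1 (flatten [seq rcons (nseq p.1.-1 None) (Some p.2)
    | p <- zip ks as_]) = zip ks as_.
  elim: ks as_ sz pos => [|k ks ih] [|a as_] //= [sz] /andP[k0 pos].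
  rewrite -{2}(ih _ sz pos) cat_rcons.
  have aux l i w : zparse l (nseq i None ++ Some a :: w)
      = ((l + i)%N, a) :: zparse 1 w.
    by elim: i l => [|i IH] l /=; rewrite ?addn0// IH addSnnS.
  by rewrite aux add1n (prednK k0).
by rewrite unzip1_zip ?unzip2_zip ?sz.
Qed.

Lemma A0B N (w1 w2 : Aalg N) : A0 w1 -> A0 w2 -> A0 (w1 - w2).
Proof.
move=> [c1 [u1 [v1 ->]]] [c2 [u2 [v2 ->]]].
exists (c1 - c2), (fun a => u1 a - u2 a), (fun a b => v1 a b - v2 a b).
rewrite scalerBl opprD addrACA; congr (_ + _).
  rewrite opprD addrACA; congr (_ + _).
  by rewrite -sumrB; apply: eq_bigr => a _; rewrite mulrBr mulrBl.
rewrite -sumrB; apply: eq_bigr => a _; rewrite -sumrB; apply: eq_bigr => b _.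
by rewrite mulrBr mulrBl.
Qed.

Lemma A0_x N (u : Aalg N) a : A0 (xA N * u * yA a).
Proof.
exists 0, (fun b => if b == a then u else 0), (fun _ _ => 0).
rewrite scale0r add0r [X in _ + X]big1 ?addr0; last first.
  by move=> c _; rewrite big1// => b _; rewrite mulr0 mul0r.
rewrite (bigD1 a)//= eqxx big1 ?addr0// => b /negPf->.
by rewrite mulr0 mul0r.
Qed.

Lemma A0_y N (v : Aalg N) a b : b != 0 -> A0 (yA b * v * yA a).
Proof.
move=> b0; exists 0, (fun _ => 0),
  (fun a' b' => if (a' == a) && (b' == b) then v else 0).
rewrite scale0r add0r big1 ?add0r; last by move=> c _; rewrite mulr0 mul0r.
rewrite (bigD1 a)//= (bigD1 b)//= !eqxx [X in _ + X + _]big1 ?addr0; last first.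
  by move=> c /andP[_ /negPf->]; rewrite mulr0 mul0r.
rewrite big1 ?addr0// => c /negPf->.
by rewrite big1// => d _; rewrite mulr0 mul0r.
Qed.

Lemma zprod_last N k ks (b : ZmodN N) as_ :
  exists u c, zprod (k :: ks) (b :: as_) = u * yA c.
Proof.
elim: ks k b as_ => [|l ks ih] k b [|c as_]; rewrite /zprod /= big_cons ?big_nil.
1-3: by exists (xA N ^+ k.-1), b; rewrite mulr1.
have [u [d]] := ih l c as_; rewrite /zprod /= => ->.
by exists (zA k b * u), d; rewrite mulrA.
Qed.

Lemma A0_zprod N k1 k2 ks (a b : ZmodN N) as_ : (1 < k1)%N || (a != 0) ->
  A0 (zprod (k1 :: k2 :: ks) [:: a, b & as_]).
Proof.
have -> : zprod (k1 :: k2 :: ks) [:: a, b & as_] =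
  zA k1 a * zprod (k2 :: ks) (b :: as_) by rewrite /zprod /= big_cons.
have [u [c ->]] := zprod_last k2 ks b as_.
case: k1 => [|[|k]] /= h; rewrite mulrA /zA ?expr0 ?mul1r.
- exact: A0_y.
- exact: A0_y.
- have -> : xA N ^+ k.+1 * yA a * u * yA c =
    xA N * (xA N ^+ k * yA a * u) * yA c by rewrite exprS !mulrA.
  exact: A0_x.
Qed.

Lemma A0_zprodB N k1 k2 ks (a b : ZmodN N) as_ :
  A0 (zprod (k1 :: k2 :: ks) [:: a, b & as_]
      - zprod (k1 :: k2 :: ks) [:: a, b - a & as_]).
Proof.
have [->|a0] := eqVneq a 0; last by apply: A0B; apply: A0_zprod; rewrite a0 orbT.
rewrite subr0 subrr; exists 0, (fun _ => 0), (fun _ _ => 0).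
rewrite scale0r add0r !big1 ?addr0// => [c _|c _]; last by rewrite mulr0 mul0r.
by rewrite big1// => d _; rewrite mulr0 mul0r.
Qed.

End Facts.

(* Main.v *)
(* Read each index of depth n - 1 and weight k - 1 with first entry at least 2 as
   a word W. The truncated sum over m_1 < M of chi_a(m)/m times that of W expands
   exactly by the harmonic product. The partial sums of the coefficients of the
   power series Li_(y_a)(t) Li_W(t) expand exactly by the shuffle product, proved
   by applying t d/dt. The two differ by the terms c_W(j) chi_a(i)/i with
   i, j < M <= i + j, and since c_W(j) = O((1 + H_j)^r / j^2) this difference is
   at most (1 + H_M)^(r+2) / M, which tends to 0. No regularization is needed:
   for a = 0 the two divergent series on the right-hand side have identical
   truncations. Summing the resulting relation over all W gives the theorem. *)
Require Import Defs.
From mathcomp Require Import all_boot all_order all_algebra ring lra zify.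
From mathcomp Require Import all_classical all_reals all_analysis.
Set Implicit Arguments.
Unset Strict Implicit.
Unset Printing Implicit Defensive.
Import Order.TTheory GRing.Theory Num.Theory.
Local Open Scope ring_scope.

(** The differences of indices in the theorem come from two descriptions of one coefficient. In
    x^(k_1-1) y_(b_1) x^(k_2-1) y_(b_2) ... the letter y_(b_i) contributes chi_(b_i) at the gap m_i
    - m_(i+1); as chi is multiplicative in both arguments, the product over i is that of chi_(b_i -
    b_(i-1)) at m_i, with b_0 = 0. So the shuffle product inserts y_a into a_1, a_2, ..., whereas
    the harmonic product inserts z_(1,a) into the list of consecutive differences. Fixed depth and
    weight, rather than a single W, are forced by the shuffle side: y_a placed inside x^(k-1) y_b
    cuts k into every pair (p+1, k-p), and only the sum over all W makes each admissible index occur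
    exactly once for a given position of y_a. W starts with x so that c_W(j) decays like 1/j^2 up to
    logarithms: the tail of the chi_a(i)/i over M - j <= i < M costs a factor j, and 1/j is then
    left, whose sum is again only logarithmic. *)

(** * Cauchy products of coefficient sequences *)

Section Convolution.
Variable F : comNzRingType.
Implicit Types f g h : nat -> F.

Definition conv f g (M : nat) : F := \sum_(i < M.+1) f i * g (M - i)%N.

(** Truncated generating polynomials lend their ring structure to [conv]: commutativity and
    associativity are read off from coefficient M of a polynomial product. *)
Lemma conv_polyE f g M K : (M < K)%N ->
  conv f g M = (\poly_(i < K) f i * \poly_(i < K) g i)`_M.
Proof.
move=> MK; rewrite coefM; apply: eq_bigr => i _.
have iK : (i < K)%N by apply: leq_ltn_trans MK; rewrite -ltnS.
by rewrite !coef_poly iK (leq_ltn_trans (leq_subr i M) MK).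
Qed.

Lemma eq_conv f f' g g' M :
  (forall i, (i <= M)%N -> f i = f' i) -> (forall i, (i <= M)%N -> g i = g' i) ->
  conv f g M = conv f' g' M.
Proof.
move=> ff gg; apply: eq_bigr => i _.
by rewrite ff ?gg ?leq_subr// -ltnS.
Qed.

Lemma convC f g M : conv f g M = conv g f M.
Proof. by rewrite !(conv_polyE _ _ (ltnSn M)) mulrC. Qed.

Lemma convA f g h M : conv f (conv g h) M = conv (conv f g) h M.
Proof.
pose P (u : nat -> F) := \poly_(i < M.+1) u i.
have PE u v i : (i <= M)%N -> conv u v i = (P u * P v)`_i.
  by move=> iM; apply: conv_polyE.
have -> : conv f (conv g h) M = (P f * (P g * P h))`_M.
  rewrite coefM; apply: eq_bigr => i _; rewrite coef_poly ltn_ord PE//.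
  exact: leq_subr.
rewrite mulrA coefM; apply: eq_bigr => i _.
by rewrite coef_poly ltnS leq_subr PE// -ltnS.
Qed.

Lemma convCA f g h M : conv f (conv g h) M = conv g (conv f h) M.
Proof.
rewrite !convA; apply: eq_conv => // i _; exact: convC.
Qed.

Lemma conv_sumr (I : Type) (s : seq I) f (g : I -> nat -> F) M :
  conv f (fun m => \sum_(x <- s) g x m) M = \sum_(x <- s) conv f (g x) M.
Proof.
rewrite exchange_big /=; apply: eq_bigr => i _; exact: big_distrr.
Qed.

(* Multiplication of the M-th term by M is t d/dt on generating series, a
   derivation of the Cauchy product. *)
Lemma conv_derivation f g M : M%:R * conv f g M =
  conv (fun m => m%:R * f m) g M + conv f (fun m => m%:R * g m) M.
Proof.
rewrite big_distrr -big_split /=; apply: eq_bigr => i _.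
have iM : (i <= M)%N by rewrite -ltnS.
have -> : M%:R = i%:R + (M - i)%:R :> F by rewrite -natrD subnKC.
ring.
Qed.

Lemma conv_delta f M : conv f (fun m => (m == 0%N)%:R) M = f M.
Proof.
rewrite /conv big_ord_recr /= subnn mulr1 big1 ?add0r// => i _.
by rewrite subn_eq0 leqNgt ltn_ord mulr0.
Qed.

End Convolution.

(** * Harmonic and shuffle products of a one-letter word with an arbitrary word *)

Section DoubleShuffle.
Variables (F : numFieldType) (V : zmodType) (chi : V -> nat -> F).
Implicit Types (a b : V) (ks : seq nat) (bs : seq V).

(* The term m = 0 vanishes when k >= 1, because 0^-1 = 0. *)
Fixpoint trunc ks bs (M : nat) : F :=
  if ks is k :: ks' then
    \sum_(m < M) chi (head 0 bs) m / m%:R ^+ k * trunc ks' (behead bs) m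
  else 1.

(** Coefficients of Li_(y_a)(t) and, in [echi], of its image under t d/dt. At m = 0 the division by
    zero already gives 0 here, but [echi] needs an explicit guard. *)
Definition hchi a (m : nat) : F := chi a m / m%:R.
Definition echi b (m : nat) : F := chi b m *+ (0 < m)%N.

(* The coefficient of t^m in the multiple polylogarithm attached to the word
   x^(k_1-1) y_(b_1) x^(k_2-1) y_(b_2) ... of the shuffle algebra. *)
Fixpoint pcoef ks bs : nat -> F :=
  if ks is k :: ks' then
    fun M => conv (echi (head 0 bs)) (pcoef ks' (behead bs)) M / M%:R ^+ k
  else fun m => (m == 0%N)%:R.

Fixpoint stuffle a ks bs : seq (seq nat * seq V) :=
  if ks is k :: ks' then
    [:: (1%N :: ks, a :: bs), (k.+1 :: ks', a + head 0 bs :: behead bs) &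
       [seq (k :: p.1, head 0 bs :: p.2) | p <- stuffle a ks' (behead bs)]]
  else [:: ([:: 1%N], [:: a])].

(** Placing y_a after p of the letters of x^(k-1) y_b gives x^p y_a x^(k-1-p) y_b, that is, the
    entries p+1 and k-p. *)
Fixpoint shuffle a ks bs : seq (seq nat * seq V) :=
  if ks is k :: ks' then
    [seq ([:: p.+1, (k - p)%N & ks'], a :: bs) | p <- iota 0 k] ++
    [seq (k :: p.1, head 0 bs :: p.2) | p <- shuffle a ks' (behead bs)]
  else [:: ([:: 1%N], [:: a])].

Fixpoint dif b bs : seq V := if bs is c :: bs' then c - b :: dif c bs' else [::].

(** The square of index pairs is cut into the two open triangles and the diagonal; in [stuffleE] the
    diagonal produces the merged word. *)
Lemma mul_partial_sums (f g : nat -> F) M :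
  (\sum_(m < M) f m) * (\sum_(m < M) g m) =
  \sum_(m < M) f m * (\sum_(j < m) g j) + \sum_(m < M) f m * g m +
  \sum_(m < M) g m * (\sum_(j < m) f j).
Proof.
elim: M => [|M IH]; first by rewrite !big_ord0; ring.
rewrite !big_ord_recr /= mulrDl !mulrDr IH; ring.
Qed.

Section Stuffle.
Hypothesis chiD : forall a b m, chi (a + b) m = chi a m * chi b m.

Lemma stuffleE a ks bs M : size bs = size ks ->
  trunc [:: 1%N] [:: a] M * trunc ks bs M =
  \sum_(p <- stuffle a ks bs) trunc p.1 p.2 M.
Proof.
elim: ks bs M => [|k ks IH] bs M; first by rewrite big_seq1 mulr1.
case: bs => // b bs [szb] /=.
rewrite (mul_partial_sums (fun m => chi a m / m%:R ^+ 1 * 1)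
  (fun m => chi b m / m%:R ^+ k * trunc ks bs m)) !big_cons big_map -addrA; congr (_ + (_ + _)).
- by apply: eq_bigr => m _; rewrite mulr1.
- apply: eq_bigr => m _; rewrite chiD [in RHS]exprS invfM expr1 -/trunc /=; ring.
- rewrite /= exchange_big /=; apply: eq_bigr => m _.
  by rewrite -big_distrr /= -IH//= -mulrA [trunc _ _ _ * _]mulrC.
Qed.

End Stuffle.

Section Shuffle.

Lemma pcoef0 k ks bs : (0 < k)%N -> pcoef (k :: ks) bs 0 = 0.
Proof. by case: k => //= k _; rewrite expr0n invr0 mulr0. Qed.

(** On generating series, t d/dt strips a leading x; in [pcoef1] it strips a leading y_b, at the
    cost of a factor with coefficients [echi b]. *)
Lemma pcoefS k ks bs M :
  M%:R * pcoef (k.+2 :: ks) bs M = pcoef (k.+1 :: ks) bs M.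
Proof.
rewrite /=; have [->|M0] := eqVneq M 0%N; first by rewrite !expr0n invr0 !mulr0.
by rewrite [in LHS]exprS invfM mulrCA mulVKf// pnatr_eq0.
Qed.

Lemma conv_echi b f M :
  conv (echi b) f M = \sum_(i < M) chi b (M - i)%N * f i.
Proof.
rewrite /conv big_ord_recl /echi mulr0n mul0r add0r.
rewrite (reindex_inj rev_ord_inj) /=; apply: eq_bigr => i _.
rewrite (_ : bump 0 (M - i.+1) = M - i)%N; last by rewrite /bump leq0n add1n subnSK.
by rewrite mulr1n subKn// ltnW.
Qed.

Lemma conv_echi0 b f : conv (echi b) f 0 = 0.
Proof. by rewrite /conv big_ord1 /echi mulr0n mul0r. Qed.

Lemma pcoef1 ks bs M : M%:R * pcoef (1%N :: ks) bs M =
  conv (echi (head 0 bs)) (pcoef ks (behead bs)) M.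
Proof.
rewrite /=; have [->|M0] := eqVneq M 0%N; first by rewrite mul0r conv_echi0.
by rewrite expr1; field; rewrite pnatr_eq0.
Qed.

Lemma hchiM a m : m%:R * hchi a m = echi a m.
Proof.
rewrite /hchi /echi; case: m => [|m]; first by rewrite mul0r.
by rewrite mulr1n mulrC divfK ?pnatr_eq0.
Qed.

Lemma shuffle_wf a ks bs p : all (leq 1) ks -> size bs = size ks ->
  p \in shuffle a ks bs ->
  [/\ (0 < size p.1)%N, all (leq 1) p.1 & size p.2 = size p.1].
Proof.
elim: ks bs p => [|k ks IH] [|b bs] p //=; first by rewrite inE => _ _ /eqP ->.
move=> /andP[k0 pos] [sz]; rewrite mem_cat => /orP[] /mapP[q qin ->] /=.
  split=> //; last by rewrite sz.
  by rewrite pos subn_gt0 andbT; move: qin; rewrite mem_iota.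
by have [_ -> ->] := IH _ _ pos sz qin; rewrite k0.
Qed.

Lemma big_shuffle_cons a k ks b bs (G : seq nat * seq V -> F) :
  \sum_(p <- shuffle a (k :: ks) (b :: bs)) G p =
  \sum_(p <- iota 0 k) G ([:: p.+1, (k - p)%N & ks], [:: a, b & bs]) +
  \sum_(p <- shuffle a ks bs) G (k :: p.1, b :: p.2).
Proof. by rewrite /= big_cat !big_map. Qed.

(** Both sides vanish at M = 0, so it suffices to compare them after multiplication by M. The
    derivation acting on [hchi a] gives the word that starts with y_a; acting on the other factor it
    strips the first letter of the word, which is an x (inner induction on the first entry) or a y
    (outer induction on the depth). *)
Lemma shuffleE a ks bs M : size bs = size ks -> all (leq 1) ks ->
  conv (hchi a) (pcoef ks bs) M = \sum_(p <- shuffle a ks bs) pcoef p.1 p.2 M.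
Proof.
have at0 ks' bs' : all (leq 1) ks' -> size bs' = size ks' -> conv (hchi a) (pcoef ks' bs') 0 =
    \sum_(p <- shuffle a ks' bs') pcoef p.1 p.2 0.
  move=> pos sz; rewrite /conv big_ord1 /hchi invr0 mulr0 mul0r big_seq big1//.
  move=> [[|k' ks''] bs''] /(shuffle_wf pos sz)[]// _ /andP[k0 _] _.
  exact: pcoef0.
elim: ks bs M => [|k ks IH] bs M.
  by rewrite big_seq1 conv_delta /= conv_delta /hchi /echi; case: M => [|M] //;
     rewrite invr0 !mulr0.
case: bs => // b bs [szb] /andP[k0 pos].
case: k k0 => // k _; elim: k M => [|k IHk] M.
  have [->|M0] := posnP M; first by apply: at0; rewrite //= szb.
  have MN0 : M%:R != 0 :> F by rewrite pnatr_eq0 -lt0n.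
  apply: (mulfI MN0); rewrite conv_derivation /= big_cons big_map mulrDr.
  congr (_ + _).
    rewrite (pcoef1 [:: 1%N & ks] [:: a, b & bs]).
    by apply: eq_conv => // i _; exact: hchiM.
  rewrite (eq_conv (f' := hchi a)
    (g' := conv (echi b) (pcoef ks bs)))// => [|i _]; last exact: (pcoef1 _ (b :: bs)).
  (* The factor [echi b] is moved outside, so that the outer hypothesis applies to the shorter
     word. *)
  rewrite convCA big_distrr /=.
  under eq_conv => [i _|i _] do [over|rewrite IH//; over].
  rewrite conv_sumr; apply: eq_bigr => p _.
  by rewrite expr1 mulrCA mulfV// mulr1.
have [->|M0] := posnP M; first by apply: at0; rewrite //= szb.
have MN0 : M%:R != 0 :> F by rewrite pnatr_eq0 -lt0n.
apply: (mulfI MN0); rewrite conv_derivation.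
rewrite (eq_conv (f' := echi a) (g' := pcoef (k.+2 :: ks) (b :: bs)))//; last first.
  by move=> i _; exact: hchiM.
rewrite [X in _ + X](eq_conv (f' := hchi a) (g' := pcoef (k.+1 :: ks) (b :: bs)))//; last first.
  by move=> i _; exact: pcoefS.
rewrite IHk -(pcoef1 _ (a :: b :: bs)) !big_shuffle_cons.
(* The case p = 0 is the word starting with y_a; the words with p > 0 start with x and, once it is
   stripped, are those of [IHk] at p - 1. *)
have -> : iota 0 k.+2 = 0%N :: map succn (iota 0 k.+1) by rewrite -(iotaDl 1).
rewrite [in RHS]big_cons big_map subn0 -addrA [RHS]mulrDr; congr (_ + _).
rewrite [RHS]mulrDr !big_distrr; congr (_ + _).
  by apply: eq_bigr => p _; rewrite -(pcoefS _ _ (a :: b :: bs)) subSS.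
by apply: eq_bigr => p _; rewrite -(pcoefS _ _ (b :: p.2)).
Qed.

End Shuffle.

Section Coefficients.
Hypothesis chiD : forall a b m, chi (a + b) m = chi a m * chi b m.
Hypothesis chiDm : forall a m m', chi a (m + m') = chi a m * chi a m'.

(** The characters telescope: chi_b at the gap M - i times chi_(b1) at i equals chi_b at M times
    chi_(b1 - b) at i, which passes the difference on to the next letter. *)
Lemma pcoefE k ks b bs M : all (leq 1) (k :: ks) -> size bs = size ks ->
  pcoef (k :: ks) (b :: bs) M = chi b M / M%:R ^+ k * trunc ks (dif b bs) M.
Proof.
elim: ks k b bs M => [|k1 ks IH] k b bs M.
  case: bs => // /andP[k0 _] _.
  rewrite /= conv_delta mulr1 /echi; case: M => [|M]; last by rewrite mulr1n.
  by rewrite expr0n gtn_eqF// invr0 !mulr0.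
case: bs => // b1 bs /= /and3P[k0 k10 pos] [szb].
rewrite [RHS]mulrAC; congr (_ / _).
rewrite conv_echi big_distrr /=; apply: eq_bigr => i _.
rewrite -[_ / i%:R ^+ k1]/(pcoef (k1 :: ks) (b1 :: bs) i).
rewrite IH//; last by rewrite /= k10.
have -> : chi b M = chi b (M - i)%N * chi b i by rewrite -chiDm subnK// ltnW.
have -> : chi b1 i = chi (b1 - b) i * chi b i by rewrite -chiD subrK.
ring.
Qed.

Lemma trunc_pcoef ks bs M : (0 < size ks)%N -> all (leq 1) ks ->
  size bs = size ks -> trunc ks (dif 0 bs) M = \sum_(m < M) pcoef ks bs m.
Proof.
case: ks => // k ks _ pos; case: bs => // b bs [szb].
by rewrite [LHS]/= subr0; apply: eq_bigr => m _; rewrite pcoefE.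
Qed.

End Coefficients.
End DoubleShuffle.

(** * The two products as explicit sums over the position of the inserted letter *)

Section ClosedForms.
Variables (W V : zmodType).
Implicit Types (a : V) (ks : seq nat) (bs : seq V) (G : seq nat * seq V -> W).

(** With the position i made explicit, the letters no longer depend on the entries of [ks], so for
    each i the sum over compositions can be reindexed separately. *)
Lemma big_shuffle a ks bs G : size bs = size ks ->
  \sum_(p <- shuffle a ks bs) G p =
  \sum_(0 <= i < size ks) \sum_(p <- iota 0 (nth 0%N ks i))
    G (take i ks ++ [:: p.+1, (nth 0%N ks i - p)%N & drop i.+1 ks],
       take i bs ++ a :: drop i bs) +
  G (ks ++ [:: 1%N], bs ++ [:: a]).
Proof.
elim: ks bs G => [|k ks IH] [|b bs] G //=; first by rewrite big_geq// big_seq1 add0r.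
move=> [sz]; rewrite big_cat !big_map big_nat_recl//= drop0 -addrA; congr (_ + _).
by rewrite (IH bs (fun p => G (k :: p.1, b :: p.2)) sz).
Qed.

Lemma big_stuffle a ks bs G : size bs = size ks ->
  \sum_(p <- stuffle a ks bs) G p =
  \sum_(0 <= i < (size ks).+1)
    G (take i ks ++ 1%N :: drop i ks, take i bs ++ a :: drop i bs) +
  \sum_(0 <= i < size ks)
    G (take i ks ++ (nth 0%N ks i).+1 :: drop i.+1 ks,
       take i bs ++ a + nth 0 bs i :: drop i.+1 bs).
Proof.
elim: ks bs G => [|k ks IH] [|b bs] G //=.
  by rewrite big_nat1 big_geq// big_seq1 addr0.
move=> [sz]; rewrite 2![in LHS]big_cons big_map [X in _ = X + _]big_nat_recl//= [X in _ = _ + X]big_nat_recl//=.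
rewrite !drop0 -addrA; congr (_ + _); rewrite addrCA; congr (_ + _).
by rewrite (IH bs (fun p => G (k :: p.1, b :: p.2)) sz).
Qed.

End ClosedForms.

(** * Bijections between sets of compositions *)

Section Reindexing.
Variable W : zmodType.
Implicit Types (ks : seq nat) (G : seq nat -> W) (P : pred (seq nat)).

Lemma big_seq_bij (I J : eqType) (s : seq I) (t : seq J) (P : pred I)
    (Q : pred J) (f : I -> J) (g : J -> I) (G : J -> W) :
  uniq s -> uniq t ->
  {in s, forall x, P x -> [&& f x \in t, Q (f x) & g (f x) == x]} ->
  {in t, forall y, Q y -> [&& g y \in s, P (g y) & f (g y) == y]} ->
  \sum_(x <- s | P x) G (f x) = \sum_(y <- t | Q y) G y.
Proof.
move=> us ut fP gP; rewrite -big_filter -[RHS]big_filter -(big_map f xpredT).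
apply: perm_big; apply: uniq_perm; last 1 first.
- move=> y; apply/mapP/idP => [[x]|].
    by rewrite !mem_filter => /andP[Px xs] ->; have /and3P[-> ->] := fP _ xs Px.
  rewrite mem_filter => /andP[Qy yt]; have /and3P[gs Pg /eqP fg] := gP _ yt Qy.
  by exists (g y) => //; rewrite mem_filter Pg.
- rewrite map_inj_in_uniq ?filter_uniq// => x y.
  rewrite !mem_filter => /andP[Px xs] /andP[Py ys] fxy.
  have /and3P[_ _ /eqP <-] := fP _ xs Px; have /and3P[_ _ /eqP <-] := fP _ ys Py.
  by rewrite fxy.
- exact: filter_uniq.
Qed.

(** A position becomes the length of a prefix, after which [catE] evaluates every [take], [drop] and
    [nth]. *)
Lemma split_nth ks i : (i < size ks)%N ->
  exists s1 x s2, ks = s1 ++ x :: s2 /\ i = size s1.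
Proof.
move=> ik; exists (take i ks), (nth 0%N ks i), (drop i.+1 ks).
by rewrite -drop_nth// cat_take_drop size_take ik.
Qed.

Lemma split_leq ks i : (i <= size ks)%N ->
  exists s1 s2, ks = s1 ++ s2 /\ i = size s1.
Proof.
by move=> ik; exists (take i ks), (drop i ks); rewrite cat_take_drop size_takel.
Qed.

Lemma take_cat0 (T : Type) (s1 s2 : seq T) : take (size s1) (s1 ++ s2) = s1.
Proof. exact: take_size_cat. Qed.

Lemma drop_cat0 (T : Type) (s1 s2 : seq T) : drop (size s1) (s1 ++ s2) = s2.
Proof. exact: drop_size_cat. Qed.

Lemma drop_cat1 (T : Type) (s1 s2 : seq T) :
  drop (size s1).+1 (s1 ++ s2) = drop 1 s2.
Proof. by rewrite -addn1 addnC -drop_drop drop_cat0. Qed.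

Lemma drop_cat2 (T : Type) (s1 s2 : seq T) :
  drop (size s1).+2 (s1 ++ s2) = drop 2 s2.
Proof. by rewrite -addn2 addnC -drop_drop drop_cat0. Qed.

Lemma nth_cat0 (s1 s2 : seq nat) : nth 0%N (s1 ++ s2) (size s1) = nth 0%N s2 0.
Proof. by rewrite nth_cat ltnn subnn. Qed.

Lemma nth_cat1 (s1 s2 : seq nat) :
  nth 0%N (s1 ++ s2) (size s1).+1 = nth 0%N s2 1.
Proof. by rewrite nth_cat ltnNge leqnSn subSnn. Qed.

Definition catE := (take_cat0, drop_cat0, drop_cat1, drop_cat2, nth_cat0, nth_cat1).

Lemma size_composition m K ks : ks \in compositions m K -> size ks = m.
Proof. by rewrite mem_compositions => /and3P[/eqP]. Qed.

Lemma mem_compositions_cat s1 s2 m K : (s1 ++ s2 \in compositions m K) =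
  [&& (size s1 + size s2 == m)%N, all (leq 1) s1 && all (leq 1) s2 &
      (sumn s1 + sumn s2 == K)%N].
Proof. by rewrite mem_compositions size_cat all_cat sumn_cat. Qed.

(** Replacing an entry x by p+1 and x-p, with p < x, raises the weight by one. Every pair (u, v) of
    positive entries arises exactly once, from x = u + v - 1 and p = u - 1. *)
Lemma big_comp_split m K i P G : (i < m)%N ->
  \sum_(ks <- compositions m K | P ks) \sum_(p <- iota 0 (nth 0%N ks i))
    G (take i ks ++ [:: p.+1, (nth 0%N ks i - p)%N & drop i.+1 ks]) =
  \sum_(ks <- compositions m.+1 K.+1 | P (take i ks ++
      (nth 0%N ks i + nth 0%N ks i.+1).-1 :: drop i.+2 ks)) G ks.
Proof.
move=> im; pose f (q : seq nat * nat) := take i q.1 ++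
  [:: q.2.+1, (nth 0%N q.1 i - q.2)%N & drop i.+1 q.1].
pose g ks := (take i ks ++ (nth 0%N ks i + nth 0%N ks i.+1).-1 :: drop i.+2 ks,
  (nth 0%N ks i).-1).
pose s := [seq (ks, p) | ks <- compositions m K, p <- iota 0 (nth 0%N ks i)].
transitivity (\sum_(q <- s | P q.1) G (f q)).
  rewrite [RHS]big_mkcond big_allpairs_dep [LHS]big_mkcond; apply: eq_bigr => ks _ /=.
  by case: (P ks) => //; rewrite big1.
apply: (@big_seq_bij _ _ _ _ _ _ f g).
- apply: allpairs_uniq_dep => [|ks _|[x y] [x' y'] _ _ /= [-> ->]//].
    exact: compositions_uniq.
  exact: iota_uniq.
- exact: compositions_uniq.
- move=> _ /allpairsPdep[ks [p [+ + ->]]] /=; rewrite mem_compositions mem_iota.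
  move=> /and3P[/eqP sz]; rewrite -sz in im; have [s1 [x [s2 [E iE]]]] := split_nth im.
  rewrite /f /g /= E iE all_cat sumn_cat => /= /and3P[a1 x0 a2] /eqP sm.
  rewrite !catE /= ?drop0 => px Pks.
  have -> : (p + (x - p) = x)%N by lia.
  rewrite Pks eqxx andbT mem_compositions -sz E !size_cat /= all_cat /= a1 a2.
  rewrite sumn_cat /=.
  lia.
- move=> ks'; rewrite mem_compositions => /and3P[/eqP sz].
  have im' : (i < size ks')%N by lia.
  have [s1 [x [[|y s2] [E iE]]]] := split_nth im'.
    by move: sz; rewrite E size_cat /=; lia.
  rewrite E iE all_cat sumn_cat => /= /and4P[a1 x0 y0 a2] /eqP sm.
  rewrite /f /g /= iE !catE /= ?drop0 => Pks.
  rewrite Pks andTb; apply/andP; split.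
    apply/allpairsPdep; exists (s1 ++ (x + y).-1 :: s2), x.-1; split=> //.
      rewrite mem_compositions size_cat all_cat sumn_cat /= a1 a2.
      move: sz; rewrite E size_cat /= => sz.
      lia.
    by rewrite mem_iota iE !catE /=; lia.
  apply/eqP; congr (_ ++ _ :: _ :: _); lia.
Qed.

Lemma big_comp_insert m K i P G : (i <= m)%N ->
  \sum_(ks <- compositions m K | P ks) G (take i ks ++ 1%N :: drop i ks) =
  \sum_(ks <- compositions m.+1 K.+1 |
      (nth 0%N ks i == 1%N) && P (take i ks ++ drop i.+1 ks)) G ks.
Proof.
move=> im; apply: (@big_seq_bij _ _ _ _ _ _
    (fun ks : seq nat => take i ks ++ 1%N :: drop i ks)
    (fun ks : seq nat => take i ks ++ drop i.+1 ks)).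
- exact: compositions_uniq.
- exact: compositions_uniq.
- move=> ks ksc; have im' : (i <= size ks)%N by rewrite (size_composition ksc).
  move: ksc; have [s1 [s2 [-> ->]]] := split_leq im'.
  rewrite mem_compositions_cat => /and3P[sz /andP[a1 a2] sm] Pks.
  rewrite !catE /= ?drop0 eqxx Pks mem_compositions_cat /= a1 a2 addnS eqSS sz.
  by rewrite /= addnCA add1n eqSS sm.
- move=> ks ksc; have im' : (i < size ks)%N by rewrite (size_composition ksc) ltnS.
  move: ksc; have [s1 [x [s2 [-> ->]]]] := split_nth im'.
  rewrite mem_compositions_cat => /= /and3P[sz /and3P[a1 x0 a2] sm].
  rewrite !catE /= ?drop0 => /andP[/eqP x1 Pks].
  move: sz sm; rewrite x1 Pks mem_compositions_cat a1 a2 addnS addnCA add1n !eqSS.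
  by rewrite eqxx => -> ->.
Qed.

Lemma big_comp_incr m K i P G : (i < m)%N ->
  \sum_(ks <- compositions m K | P ks)
    G (take i ks ++ (nth 0%N ks i).+1 :: drop i.+1 ks) =
  \sum_(ks <- compositions m K.+1 | (2 <= nth 0%N ks i)%N &&
      P (take i ks ++ (nth 0%N ks i).-1 :: drop i.+1 ks)) G ks.
Proof.
move=> im; apply: (@big_seq_bij _ _ _ _ _ _
    (fun ks : seq nat => take i ks ++ (nth 0%N ks i).+1 :: drop i.+1 ks)
    (fun ks : seq nat => take i ks ++ (nth 0%N ks i).-1 :: drop i.+1 ks)).
- exact: compositions_uniq.
- exact: compositions_uniq.
- move=> ks; rewrite mem_compositions => /and3P[/eqP sz].
  rewrite -sz in im; have [s1 [x [s2 [E ->]]]] := split_nth im; move: sz; rewrite E.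
  rewrite all_cat sumn_cat size_cat /= => sz /and3P[a1 x0 a2] /eqP sm Pks.
  rewrite !catE /= ?drop0 Pks eqxx andbT.
  rewrite mem_compositions size_cat all_cat sumn_cat /= a1 a2 -sz eqxx andbT /=.
  lia.
- move=> ks; rewrite mem_compositions => /and3P[/eqP sz].
  rewrite -sz in im; have [s1 [x [s2 [E ->]]]] := split_nth im; move: sz; rewrite E.
  rewrite all_cat sumn_cat size_cat /= => sz /and3P[a1 x0 a2] /eqP sm.
  rewrite !catE /= ?drop0 => /andP[x2 Pks].
  have xE : x.-1.+1 = x by lia.
  rewrite Pks xE eqxx andbT mem_compositions size_cat all_cat sumn_cat /= a1 a2 -sz.
  lia.
Qed.

End Reindexing.

(** * Growth of powers of harmonic numbers *)

Section Harmonic.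
Variable R : realType.

(** As 0^-1 = 0, this is the harmonic number H_(M-1) for M > 0. *)
Definition harm (M : nat) : R := \sum_(m < M) m%:R^-1.

Lemma harm_ge0 M : 0 <= harm M.
Proof. by apply: sumr_ge0 => i _; rewrite invr_ge0. Qed.

Lemma harmS M : harm M.+1 = harm M + M%:R^-1.
Proof. by rewrite /harm big_ord_recr. Qed.

Lemma harm_homo m M : (m <= M)%N -> harm m <= harm M.
Proof.
elim: M => [|M IH]; first by rewrite leqn0 => /eqP->.
rewrite leq_eqVlt ltnS => /orP[/eqP->//|/IH/le_trans]; apply.
by rewrite harmS lerDl invr_ge0.
Qed.

Lemma bernoulli_ge (y : R) q : 0 <= y -> y <= 1 -> 1 - q%:R * y <= (1 - y) ^+ q.
Proof.
move=> y0 y1; elim: q => [|q IH]; first by rewrite mul0r subr0.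
have q0 : 0 <= q%:R :> R by [].
rewrite exprS -natr1; apply: (@le_trans _ _ ((1 - y) * (1 - q%:R * y))).
  have := mulr_ge0 q0 (mulr_ge0 y0 y0); nra.
by apply: ler_wpM2l IH; lra.
Qed.

(** Used with u = 1/M: the q-th power then grows by a factor at most (M+1)/M, the growth rate of M
    itself. With y = u/x, (1+y)^q is at most 1/(1-y)^q, hence at most 1/(1-u/2) by Bernoulli, and
    this is at most 1+u. *)
Lemma harm_pow_step (x u : R) q : 0 < u -> u <= 1 -> 2 * q%:R <= x -> 0 < x ->
  (x + u) ^+ q <= x ^+ q * (1 + u).
Proof.
move=> u0 u1 qx x0; have q0 : 0 <= q%:R :> R by [].
have [->|qN] := eqVneq q 0%N; first by rewrite !expr0 mul1r; lra.
have q1 : 1 <= q%:R :> R by rewrite ler1n lt0n.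
pose y := u / x.
have y0 : 0 <= y by rewrite divr_ge0// ltW.
have qy : q%:R * y <= u / 2.
  rewrite /y mulrA ler_pdivrMr//; have := ler_wpM2l (ltW u0) qx; lra.
have y1 : y <= 1 by nra.
have -> : (x + u) ^+ q = x ^+ q * (1 + y) ^+ q.
  by rewrite -exprMn; congr (_ ^+ _); rewrite /y; field; rewrite gt_eqF.
apply: ler_wpM2l; first by rewrite exprn_ge0 ?ltW.
have yq0 : 0 <= (1 + y) ^+ q by apply: exprn_ge0; lra.
have h1 : (1 + y) ^+ q * (1 - y) ^+ q <= 1.
  by rewrite -exprMn exprn_ile1//; nra.
have h2 : (1 + y) ^+ q * (1 - u / 2) <= 1.
  apply: le_trans h1; apply: ler_wpM2l => //.
  by apply: le_trans (bernoulli_ge q y0 y1); lra.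
have h3 : 1 <= (1 + u) * (1 - u / 2) by nra.
have h4 : 0 < 1 - u / 2 by lra.
by have := le_trans h2 h3; rewrite ler_pM2r.
Qed.

Lemma harm_pow_le q : exists C : R,
  0 <= C /\ forall M, (0 < M)%N -> (1 + harm M) ^+ q <= C * M%:R.
Proof.
case: q => [|q].
  by exists 1; split=> // M M0; rewrite expr0 mul1r ler1n.
(* Adding this shift to [harm M] puts the base in the range of [harm_pow_step] from M = 1 on. *)
pose c : R := 2 * q.+1%:R.
have c1 : 1 <= c by rewrite /c -natrM ler1n.
have key M : (0 < M)%N -> (harm M + c) ^+ q.+1 <= c ^+ q.+1 * M%:R.
  elim: M => // -[_ _|M IH _].
    by rewrite /harm big_ord1 invr0 add0r mulr1.
  rewrite harmS addrAC; apply: le_trans (harm_pow_step _ _ _ _) _.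
  - by rewrite invr_gt0.
  - by rewrite invf_le1// ler1n.
  - by rewrite lerDr harm_ge0.
  - by have := harm_ge0 M.+1; lra.
  apply: (@le_trans _ _ (c ^+ q.+1 * M.+1%:R * (1 + M.+1%:R^-1))).
    by rewrite ler_wpM2r ?IH// addr_ge0// invr_ge0.
  by rewrite -mulrA mulrDr mulr1 mulfV ?pnatr_eq0// natr1.
exists (c ^+ q.+1); split; first by apply: exprn_ge0; lra.
move=> M M0; apply: le_trans (key M M0); have := harm_ge0 M => h0.
by rewrite lerXn2r ?nnegrE; lra.
Qed.

(** The linear bound for the doubled exponent, under a square root. Half a power of M is saved,
    enough both for summability against 1/m^2 and for the limit 0 after division by M. *)
Lemma harm_pow_sqrt q : exists C : R,
  0 <= C /\ forall M, (0 < M)%N -> (1 + harm M) ^+ q <= C * Num.sqrt M%:R.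
Proof.
have [C [C0 HC]] := harm_pow_le (q * 2).
exists (Num.sqrt C); split=> [|M M0]; first exact: sqrtr_ge0.
rewrite -sqrtrM// -[leLHS]ger0_norm; last first.
  by apply: exprn_ge0; have := harm_ge0 M; lra.
by rewrite -sqrtr_sqr -exprM ler_wsqrtr// HC.
Qed.

(** Discrete form of the integral of x^(-3/2): for j >= 2 the j-th term is at most 2/sqrt(j-1) -
    2/sqrt(j), and the first term is 1 = 3 - 2. *)
Lemma sum_inv_sqrt3_le M : \sum_(m < M) (m%:R * Num.sqrt m%:R)^-1 <= 3 :> R.
Proof.
have key m : \sum_(j < m.+2) (j%:R * Num.sqrt j%:R)^-1 <=
    3 - 2 / Num.sqrt m.+1%:R :> R.
  elim: m => [|m IH].
    by rewrite !big_ord_recl big_ord0 /= mul0r invr0 sqrtr1 mulr1 invr1; lra.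
  rewrite big_ord_recr /=; apply: le_trans (lerD IH (lexx _)) _.
  set s := Num.sqrt m.+1%:R; set t := Num.sqrt m.+2%:R.
  have s0 : 0 < s by rewrite sqrtr_gt0.
  have t0 : 0 < t by rewrite sqrtr_gt0.
  have t2 : t ^+ 2 = s ^+ 2 + 1 by rewrite !sqr_sqrtr// natr1.
  have -> : m.+2%:R = t ^+ 2 :> R by rewrite sqr_sqrtr.
  have st : s <= t by rewrite ler_wsqrtr// ler_nat.
  suff : (t ^+ 2 * t)^-1 <= 2 / s - 2 / t by lra.
  have -> : 2 / s - 2 / t = (2 * t ^+ 2 * (t - s)) / (t ^+ 2 * t * s).
    by field; rewrite !gt_eqF.
  have -> : (t ^+ 2 * t)^-1 = s / (t ^+ 2 * t * s) by field; rewrite !gt_eqF.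
  rewrite ler_pM2r ?invr_gt0 ?mulr_gt0 ?exprn_gt0//.
  (* Hence t - s = 1/(t+s) >= 1/(2t), so that 2 t^2 (t - s) >= t >= s. *)
  have h : (t - s) * (t + s) = 1 by move: t2; rewrite !expr2; lra.
  nra.
case: M => [|[|m]].
- by rewrite big_ord0.
- by rewrite big_ord1 /= mul0r invr0.
- apply: le_trans (key m) _; rewrite gerBl divr_ge0//; exact: sqrtr_ge0.
Qed.

Lemma sum_harm_pow_div2 q :
  exists B : R, forall M, \sum_(m < M) (1 + harm m) ^+ q / m%:R ^+ 2 <= B.
Proof.
have [C [C0 HC]] := harm_pow_sqrt q.
exists (C * 3) => M; apply: (@le_trans _ _
    (\sum_(m < M) C * (m%:R * Num.sqrt m%:R)^-1)); last first.
  by rewrite -big_distrr /= ler_wpM2l// sum_inv_sqrt3_le.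
apply: ler_sum => m _; have [->|m0] := posnP m.
  by rewrite expr0n invr0 mulr0 mul0r invr0 mulr0.
apply: le_trans (ler_wpM2r _ (HC _ m0)) _; first by rewrite invr_ge0 exprn_ge0.
set s := Num.sqrt m%:R; have s0 : 0 < s by rewrite sqrtr_gt0 ltr0n.
have -> : m%:R = s ^+ 2 by rewrite sqr_sqrtr.
have -> // : C * s / (s ^+ 2) ^+ 2 = C * (s ^+ 2 * s)^-1.
by field; rewrite gt_eqF.
Qed.

Lemma harm_pow_div_cvg0 q :
  ((1 + harm M) ^+ q / M%:R @[M --> \oo] --> (0 : R))%classic.
Proof.
have [C [C0 HC]] := harm_pow_sqrt q.
apply/cvgr0Pnorm_le => e e0.
have [n _ nP] := @nbhs_infty_gtr R ((C / e) ^+ 2).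
exists n.+1 => //= M /= nM; have M0 : (0 < M)%N by exact: leq_ltn_trans nM.
have h0 := harm_ge0 M.
rewrite ger0_norm; last by rewrite divr_ge0// exprn_ge0//; lra.
rewrite ler_pdivrMr ?ltr0n//; apply: le_trans (HC _ M0) _.
set s := Num.sqrt M%:R; have s0 : 0 < s by rewrite sqrtr_gt0 ltr0n.
have -> : M%:R = s ^+ 2 by rewrite sqr_sqrtr.
rewrite expr2 mulrA ler_pM2r// mulrC -ler_pdivrMr//.
have Ce : 0 <= C / e by rewrite divr_ge0// ltW.
rewrite -[C / e]ger0_norm// -sqrtr_sqr ler_wsqrtr//.
by apply/ltW/nP => /=; exact: ltnW.
Qed.

End Harmonic.

(** * Complex limits controlled by real bounds *)

Section ComplexSequences.
Variable R : realType.
Notation C := (Cplx R).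

(** The norm of [Cplx] takes complex values; bounds have the form [rc x] so that the estimates
    themselves stay real. *)
Definition rc (x : R) : C := (x%:C)%C.

Lemma rcD x y : rc (x + y) = rc x + rc y. Proof. exact: rmorphD. Qed.
Lemma rcB x y : rc (x - y) = rc x - rc y. Proof. exact: rmorphB. Qed.
Lemma rcM x y : rc (x * y) = rc x * rc y. Proof. exact: rmorphM. Qed.
Lemma rcV x : rc x^-1 = (rc x)^-1. Proof. exact: fmorphV. Qed.
Lemma rcX x n : rc (x ^+ n) = rc x ^+ n. Proof. exact: rmorphXn. Qed.
Lemma rc_nat n : rc n%:R = n%:R. Proof. exact: rmorph_nat. Qed.
Lemma rc1 : rc 1 = 1. Proof. exact: rmorph1. Qed.
Lemma rc_sum n (f : nat -> R) : rc (\sum_(i < n) f i) = \sum_(i < n) rc (f i).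
Proof. exact: rmorph_sum. Qed.
Lemma ler_rc x y : (rc x <= rc y) = (x <= y). Proof. exact: lecR. Qed.

Lemma gt0_rc (e : C) : 0 < e -> exists2 x : R, 0 < x & e = rc x.
Proof.
case: e => x y; rewrite /rc ltcE /= => /andP[/eqP y0 x0]; exists x => //.
by rewrite y0.
Qed.

Lemma norm_rc_Re (z : C) x : `|z| <= rc x -> `|complex.Re z| <= x.
Proof. by move=> zx; rewrite -ler_rc; apply: le_trans zx; exact: normc_ge_Re. Qed.

Lemma norm_rc_Im (z : C) x : `|z| <= rc x -> `|complex.Im z| <= x.
Proof.
move=> zx; have -> : complex.Im z = - complex.Re ('i%C * z : C).
  by case: z {zx} => u v /=; rewrite mul0r mul1r add0r opprK.
rewrite normrN; apply: norm_rc_Re; rewrite normrM.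
have -> : `|'i%C : C| = 1 by rewrite normc_def /= expr0n expr1n add0r sqrtr1.
by rewrite mul1r.
Qed.

Lemma norm_rc (t : R) : `|rc t| = rc `|t|.
Proof. by rewrite normc_def /= expr0n addr0 sqrtr_sqr. Qed.

Lemma cvg_rc_bound (u : nat -> C) (l : C) (d : nat -> R) :
  (forall M, (0 < M)%N -> `|u M - l| <= rc (d M)) ->
  (d @ \oo --> (0 : R))%classic -> (u @ \oo --> l)%classic.
Proof.
move=> ud /cvgr0Pnorm_le d0; apply/cvgrPdistC_le => _ /gt0_rc[x x0 ->].
have [n _ nP] := d0 x x0; exists n.+1 => //= M /= nM.
apply: le_trans (ud _ (leq_ltn_trans (leq0n n) nM)) _; rewrite ler_rc.
by apply: le_trans (ler_norm _) (nP _ (ltnW nM)).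
Qed.

Lemma cvg_complex (u : nat -> C) (x y : R) :
  ((fun n => complex.Re (u n)) @ \oo --> x)%classic ->
  ((fun n => complex.Im (u n)) @ \oo --> y)%classic ->
  (u @ \oo --> ((x +i* y)%C : C))%classic.
Proof.
move=> ux uy.
apply: (@cvg_rc_bound _ _
    (fun n => `|complex.Re (u n) - x| + `|complex.Im (u n) - y|)).
  move=> M _; rewrite rcD; case: (u M) => p q /=.
  have -> : ((p +i* q)%C - (x +i* y)%C : C) = rc (p - x) + 'i%C * rc (q - y).
    by apply/eqP; rewrite eq_complex /=; apply/andP; split; apply/eqP; ring.
  apply: le_trans (ler_normD _ _) _; rewrite normrM.
  have -> : `|'i%C : C| = 1 by rewrite normc_def /= expr0n expr1n add0r sqrtr1.
  by rewrite mul1r !norm_rc.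
apply/cvgr0Pnorm_le => e e0; have e2 : 0 < e / 2 by rewrite divr_gt0.
move/cvgrPdistC_le: ux => /(_ _ e2) [n _ nP].
move/cvgrPdistC_le: uy => /(_ _ e2) [n' _ nP'].
exists (maxn n n') => //= M /=; rewrite geq_max => /andP[nM n'M].
rewrite ger0_norm ?addr_ge0// (splitr e); apply: lerD; first exact: nP.
exact: nP'.
Qed.

Lemma series_cvg_bound (v d : nat -> R) B :
  (forall m, `|v m| <= d m) -> (forall M, \sum_(m < M) d m <= B) ->
  cvg ((fun M => \sum_(m < M) v m) @ \oo)%classic.
Proof.
move=> vd dB.
have -> : (fun M => \sum_(m < M) v m) = series v.
  by apply/funext => M; rewrite seriesEord.
apply: (@normed_cvg R R^o v); apply: nondecreasing_is_cvgn.
  by apply: nondecreasing_series => n _ _; exact: normr_ge0.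
exists B => _ [M _ <-]; apply: le_trans (dB M).
by rewrite /normed_series_of/= seriesEord; apply: ler_sum.
Qed.

(** Real and imaginary parts are dominated by the same [d], so both are absolutely convergent real
    series. *)
Lemma cvg_abs_bound (u : nat -> C) (d : nat -> R) B :
  (forall m, `|u m| <= rc (d m)) -> (forall M, \sum_(m < M) d m <= B) ->
  cvg ((fun M => \sum_(m < M) u m) @ \oo)%classic.
Proof.
move=> ud dB.
have ReE M : complex.Re (\sum_(m < M) u m) = \sum_(m < M) complex.Re (u m).
  elim: M => [|M IH]; rewrite ?big_ord0// !big_ord_recr /= -IH.
  by case: (\sum_(_ < _) _); case: (u M).
have ImE M : complex.Im (\sum_(m < M) u m) = \sum_(m < M) complex.Im (u m).
  elim: M => [|M IH]; rewrite ?big_ord0// !big_ord_recr /= -IH.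
  by case: (\sum_(_ < _) _); case: (u M).
have /cvg_ex[/= x xP] : cvg ((fun M => \sum_(m < M) complex.Re (u m)) @ \oo)%classic.
  by apply: (@series_cvg_bound (fun m => complex.Re (u m)) d B) => // m; exact: norm_rc_Re.
have /cvg_ex[/= y yP] : cvg ((fun M => \sum_(m < M) complex.Im (u m)) @ \oo)%classic.
  by apply: (@series_cvg_bound (fun m => complex.Im (u m)) d B) => // m; exact: norm_rc_Im.
apply: (cvgP ((x +i* y)%C : C)); apply: cvg_complex.
  by under eq_fun do rewrite ReE.
by under eq_fun do rewrite ImE.
Qed.

End ComplexSequences.

(** * Convergence of the truncated sums and the error between the two products *)

Section Estimates.
Variables (R : realType) (V : zmodType) (chi : V -> nat -> Cplx R).
Hypothesis chiD : forall a b m, chi (a + b) m = chi a m * chi b m.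
Hypothesis chiDm : forall a m m', chi a (m + m') = chi a m * chi a m'.
Hypothesis chi_norm : forall a m, `|chi a m| = 1.
Implicit Types (a b : V) (ks : seq nat) (bs : seq V).

Lemma norm_chi_div a m k : `|chi a m / m%:R ^+ k| = rc (m%:R ^+ k)^-1.
Proof.
by rewrite normrM chi_norm mul1r normfV normrX normr_nat rcV rcX rc_nat.
Qed.

(** Each nested sum is majorized by the harmonic sum up to M and costs one factor. *)
Lemma trunc_bound ks bs M : all (leq 1) ks ->
  `|trunc chi ks bs M| <= rc ((1 + harm R M) ^+ size ks).
Proof.
elim: ks bs M => [|k ks IH] bs M /=.
  by rewrite normr1 expr0 rc1.
move=> /andP[k0 pos]; apply: le_trans (ler_norm_sum _ _ _) _.
apply: (@le_trans _ _ (rc (\sum_(m < M) m%:R^-1 * (1 + harm R M) ^+ size ks))).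
  rewrite (rc_sum M (fun m => m%:R^-1 * (1 + harm R M) ^+ size ks)).
  apply: ler_sum => m _; rewrite normrM norm_chi_div.
  rewrite rcM; apply: ler_pM => //.
  - by rewrite -(norm_chi_div 0).
  - rewrite ler_rc; have [->|m0] := posnP m.
      by rewrite expr0n gtn_eqF// invr0.
    rewrite lef_pV2 ?posrE ?exprn_gt0 ?ltr0n//.
    by rewrite ler_eXnr// ler1n.
  - apply: le_trans (IH _ _ pos) _.
    rewrite ler_rc lerXn2r ?nnegrE ?lerD2l ?addr_ge0 ?harm_ge0//.
    exact/harm_homo/ltnW.
rewrite ler_rc -big_distrl /= exprS ler_wpM2r ?exprn_ge0 ?addr_ge0 ?harm_ge0//.
by rewrite lerDr.
Qed.

Lemma term_bound k ks b bs m : (2 <= k)%N -> all (leq 1) ks ->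
  `|chi b m / m%:R ^+ k * trunc chi ks bs m| <=
  rc ((1 + harm R m) ^+ size ks / m%:R ^+ 2).
Proof.
move=> k2 pos; rewrite normrM norm_chi_div mulrC rcM; apply: ler_pM => //.
- by rewrite -(norm_chi_div b).
- exact: trunc_bound.
- rewrite ler_rc; have [->|m0] := posnP m.
    by rewrite !expr0n gtn_eqF ?invr0// ltnW.
  rewrite lef_pV2 ?posrE ?exprn_gt0 ?ltr0n//.
  by rewrite ler_weXn2l// ler1n.
Qed.

Lemma trunc_cvg k ks bs : (2 <= k)%N -> all (leq 1) ks ->
  cvg (trunc chi (k :: ks) bs @ \oo)%classic.
Proof.
move=> k2 pos; have [B BP] := sum_harm_pow_div2 R (size ks).
apply: (@cvg_abs_bound R
    (fun m => chi (head 0 bs) m / m%:R ^+ k * trunc chi ks (behead bs) m)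
    (fun m => (1 + harm R m) ^+ size ks / m%:R ^+ 2) B) => // m.
exact: term_bound.
Qed.

Lemma norm_hchi a m : `|hchi chi a m| = rc m%:R^-1.
Proof. by rewrite /hchi -[m%:R]expr1 norm_chi_div expr1. Qed.

(** Abel summation: multiplying by 1 - chi_a(1) turns the partial sum into that of chi_a(m) (1/m -
    1/(m-1)), which converges absolutely, minus a boundary term tending to 0. *)
Lemma hchi_sum_cvg a : chi a 1 != 1 ->
  cvg (trunc chi [:: 1%N] [:: a] @ \oo)%classic.
Proof.
move=> q1; pose q := chi a 1.
have chiS m : chi a m.+1 = chi a m * q by rewrite -addn1 chiDm.
pose t m := chi a m * (m%:R^-1 - m.-1%:R^-1).
have SE : trunc chi [:: 1%N] [:: a] = fun M =>
    (1 - q)^-1 * (\sum_(m < M) t m - chi a M / M.-1%:R).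
  apply/funext => M; apply: (mulfI (x := 1 - q)).
    by rewrite subr_eq0 eq_sym.
  rewrite mulVKf; last by rewrite subr_eq0 eq_sym.
  elim: M => [|M IH]; first by rewrite /= !big_ord0 invr0; ring.
  rewrite /= in IH *; rewrite !big_ord_recr /= mulrDr IH chiS /t expr1; ring.
rewrite SE; apply: is_cvgM; first exact: is_cvg_cst.
(* Serves both the bound 2/m^2 on [t m] and the boundary term; at m = 0 and m = 1 the left side is
   0^-1 = 0. *)
have pred_le m : (m.-1%:R^-1 : R) <= 2 / m%:R.
  case: m => [|[|m]]; rewrite ?invr0 ?mulr0// ?divr_ge0//.
  rewrite /= -[leLHS]mul1r ler_pdivrMr// mulrAC ler_pdivlMr// mul1r.
  by rewrite -natrM ler_nat mul2n -addnn addSn ltnS addnS ltnS leq_addr.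
apply: is_cvgB.
  have [B BP] := sum_harm_pow_div2 R 0.
  apply: (@cvg_abs_bound R t (fun m => 2 * (m%:R ^+ 2)^-1) (2 * B)).
    move=> m; rewrite normrM chi_norm mul1r.
    have -> : m%:R^-1 - m.-1%:R^-1 = rc (m%:R^-1 - m.-1%:R^-1) :> Cplx R.
      by rewrite rcB !rcV !rc_nat.
    rewrite norm_rc ler_rc.
    case: m => [|m]; first by rewrite /= subrr normr0 expr0n invr0 !mulr0.
    case: m => [|m]; first by rewrite /= invr0 subr0 expr1n invr1 normr1; lra.
    have := pred_le m.+2; rewrite /= => h.
    have m1 : 0 < m.+1%:R :> R by [].
    have m2 : 0 < m.+2%:R :> R by [].
    have -> : m.+2%:R^-1 - m.+1%:R^-1 = - (m.+1%:R^-1 * m.+2%:R^-1) :> R.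
      have aux (x : R) : 0 < x -> (x + 1)^-1 - x^-1 = - (x^-1 * (x + 1)^-1).
        by move=> x0; field; rewrite !gt_eqF// addr_gt0.
      by rewrite -(natr1 m.+1) aux.
    rewrite normrN ger0_norm ?mulr_ge0 ?invr_ge0//.
    apply: le_trans (ler_wpM2r _ h) _; first by rewrite invr_ge0.
    by rewrite -mulrA -invfM expr2.
  move=> M; rewrite -big_distrr ler_wpM2l//=.
  by apply: le_trans (BP M); apply: ler_sum => m _; rewrite expr0 mul1r.
apply: (cvgP (0 : Cplx R)).
apply: (@cvg_rc_bound R _ _ (fun M => 2 * ((1 + harm R M) ^+ 0 / M%:R))).
  move=> M _; rewrite subr0 normrM chi_norm mul1r normfV normr_nat.
  by rewrite -rc_nat -rcV ler_rc expr0 mul1r pred_le.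
rewrite -[0 in X in (_ --> X)%classic](mulr0 2).
by apply: cvgM; [exact: cvg_cst|exact: harm_pow_div_cvg0].
Qed.

(** The sum over m_1 > m_2 is the product of two convergent sums minus the part m_1 <= m_2. In that
    part the sum over m_1 is finite and costs one harmonic factor, so the factor 1/m_2^k makes it
    absolutely convergent. *)
Lemma trunc_cvg1 a k ks bs : (2 <= k)%N -> all (leq 1) ks -> chi a 1 != 1 ->
  cvg (trunc chi [:: 1%N, k & ks] (a :: bs) @ \oo)%classic.
Proof.
move=> k2 pos a1.
have [B BP] := sum_harm_pow_div2 R (size ks).+1.
pose h m := chi a m / m%:R ^+ 1 * 1.
pose g m := chi (head 0 bs) m / m%:R ^+ k * trunc chi ks (behead bs) m.
have -> : trunc chi [:: 1%N, k & ks] (a :: bs) = fun M =>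
    trunc chi [:: 1%N] [:: a] M * trunc chi (k :: ks) bs M -
    \sum_(m < M) g m * (\sum_(j < m.+1) h j).
  apply/funext => M; rewrite /= (mul_partial_sums h g).
  apply/eqP; rewrite eq_sym subr_eq; apply/eqP; rewrite -addrA; congr (_ + _).
    by apply: eq_bigr => m _; rewrite /h mulr1.
  rewrite -big_split; apply: eq_bigr => m _; rewrite big_ord_recr /=.
  by rewrite mulrDr addrC [h m * _]mulrC.
apply: is_cvgB.
  by apply: is_cvgM; [exact: hchi_sum_cvg|exact: trunc_cvg].
apply: (@cvg_abs_bound R (fun m => g m * (\sum_(j < m.+1) h j))
    (fun m => (1 + harm R m) ^+ (size ks).+1 / m%:R ^+ 2) B) => // m.
rewrite normrM exprSr mulrAC rcM.
apply: ler_pM => //; first exact: term_bound.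
apply: le_trans (ler_norm_sum _ _ _) _.
under eq_bigr => j _ do rewrite /h mulr1 norm_chi_div expr1.
rewrite -(rc_sum m.+1 (fun m => m%:R^-1)) ler_rc -/(harm R m.+1) harmS.
rewrite [leRHS]addrC lerD2l; case: m => [|m]; rewrite ?invr0//.
by rewrite invf_le1// ler1n.
Qed.

(** The triangle i + j < M, sliced by j. *)
Lemma sum_conv (h c : nat -> Cplx R) M : \sum_(m < M) conv h c m =
  \sum_(j < M) c j * (\sum_(i < (M - j)%N) h i).
Proof.
elim: M => [|M IH]; first by rewrite !big_ord0.
rewrite big_ord_recr /= IH convC /conv.
have -> : \sum_(j < M) c j * (\sum_(i < (M - j)%N) h i) =
    \sum_(j < M.+1) c j * (\sum_(i < (M - j)%N) h i).
  by rewrite [RHS]big_ord_recr /= subnn big_ord0 mulr0 addr0.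
rewrite -big_split; apply: eq_bigr => j _ /=.
have jM : (j <= M)%N by rewrite -ltnS.
by rewrite subSn// big_ord_recr mulrDr.
Qed.

Lemma hchi_sum_diff a m M : (m <= M)%N ->
  `|\sum_(i < M) hchi chi a i - \sum_(i < m) hchi chi a i|
  <= rc (harm R M - harm R m).
Proof.
move/subnKC => <-; elim: (M - m)%N => [|d IH].
  by rewrite addn0 !subrr normr0.
rewrite addnS big_ord_recr /= harmS addrAC [X in rc X]addrAC rcD -(norm_hchi a).
by apply: le_trans (ler_normD _ _) _; rewrite lerD2r.
Qed.

(** For M - j <= i < M and i > 0, M/i = 1 + (M-i)/i <= 1 + j/i. Summed over these j values of i,
    this gives j plus j times a part of the harmonic sum. *)
Lemma harm_sub_le j M : (j <= M)%N -> (0 < M)%N ->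
  harm R M - harm R (M - j) <= j%:R * (1 + harm R M) / M%:R.
Proof.
move=> jM M0; rewrite ler_pdivlMr ?ltr0n// mulrC.
suff key d : (d <= j)%N -> M%:R * (harm R (M - j + d) - harm R (M - j)) <=
    d%:R + j%:R * (harm R (M - j + d) - harm R (M - j)).
  have := key j (leqnn j); rewrite subnK// => /le_trans; apply.
  rewrite [leRHS]mulrDr mulr1 lerD2l ler_wpM2l// gerBl; exact: harm_ge0.
elim: d => [|d IH] dj; first by rewrite addn0 subrr !mulr0 addr0.
rewrite addnS harmS addrAC; set x := harm _ _ - _ in IH *; set i := (M - j + d)%N.
have := IH (ltnW dj) => {}IH; rewrite !(mulrDr _ x) -natr1.
suff : M%:R * i%:R^-1 <= 1 + j%:R * i%:R^-1 :> R by lra.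
have [->|i0] := posnP i; first by rewrite invr0 !mulr0 addr0.
have i0' : 0 < i%:R :> R by rewrite ltr0n.
rewrite -(ler_pM2r i0') mulrDl !mulfVK ?gt_eqF// mul1r -natrD ler_nat /i.
by rewrite -{1}(subnK jM) addnAC leq_addr.
Qed.

Lemma double_shuffle_error a k ks b bs : (2 <= k)%N -> all (leq 1) ks ->
  size bs = size ks ->
  ((fun M => trunc chi [:: 1%N] [:: a] M * trunc chi (k :: ks) (dif 0 (b :: bs)) M
     - \sum_(m < M) conv (hchi chi a) (pcoef chi (k :: ks) (b :: bs)) m)
   @ \oo --> (0 : Cplx R))%classic.
Proof.
move=> k2 pos sz; set c := pcoef _ _ _; pose r := size ks.
have posk : all (leq 1) (k :: ks) by rewrite /= (ltnW k2).
(* The exponent r + 2 counts r factors from the coefficient bound, one from [harm_sub_le] and one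
   from the remaining sum of 1/j. *)
apply: (@cvg_rc_bound R _ _ (fun M => (1 + harm R M) ^+ r.+2 / M%:R)); last first.
  exact: harm_pow_div_cvg0.
move=> M M0; rewrite subr0 (trunc_pcoef chiD chiDm)// -/c; last by rewrite /= sz.
rewrite sum_conv big_distrr /= -sumrB.
have h0 m : 0 <= 1 + harm R m by rewrite addr_ge0 ?harm_ge0.
apply: le_trans (ler_norm_sum _ _ _) _.
apply: (@le_trans _ _ (rc (\sum_(j < M)
    (1 + harm R M) ^+ r.+1 / M%:R * j%:R^-1))); last first.
  rewrite ler_rc -big_distrr /= [X in _ <= X / _]exprSr [leRHS]mulrAC.
  by rewrite ler_wpM2l ?mulr_ge0 ?invr_ge0 ?exprn_ge0// lerDr.
rewrite (rc_sum M (fun j => (1 + harm R M) ^+ r.+1 / M%:R * j%:R^-1)).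
apply: ler_sum => j _; rewrite [X in X - _]mulrC -mulrBr normrM.
have jM : (j <= M)%N by exact: ltnW.
apply: (@le_trans _ _ (rc ((1 + harm R M) ^+ r / j%:R ^+ 2) *
    rc (j%:R * (1 + harm R M) / M%:R))).
  apply: ler_pM => //.
    rewrite /c (pcoefE chiD chiDm)//; apply: le_trans (term_bound _ _ _ k2 pos) _.
    rewrite ler_rc ler_wpM2r ?invr_ge0 ?exprn_ge0//.
    by rewrite lerXn2r ?nnegrE// lerD2l harm_homo.
  have -> : \sum_(m < M) chi a m / m%:R ^+ 1 * 1 = \sum_(m < M) hchi chi a m.
    by apply: eq_bigr => m _; rewrite mulr1 expr1.
  apply: le_trans (hchi_sum_diff _ (leq_subr j M)) _.
  by rewrite ler_rc harm_sub_le.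
rewrite -rcM ler_rc; have [->|j0] := posnP j.
  by rewrite expr0n invr0 !mulr0 mul0r.
rewrite le_eqVlt; apply/orP; left; apply/eqP; rewrite [in RHS]exprSr; field.
by rewrite !pnatr_eq0 -!lt0n M0 j0.
Qed.

End Estimates.

(** * Characters of Z/NZ, and [Lstar_trunc] as a nested sum *)

Section RootsOfUnity.
Variables (R : realType) (N : nat).

Definition rchi (a : ZmodN N) (m : nat) : Cplx R := omega R N ^+ (a * m)%N.

Lemma omegaX m : omega R N ^+ m =
  (cos (m%:R * (2 * pi / N%:R)) +i* sin (m%:R * (2 * pi / N%:R)))%C.
Proof.
elim: m => [|m IH].
  by rewrite mul0r cos0 sin0 expr0.
rewrite exprS IH -(natr1 m) (mulrDl m%:R) mul1r cosD sinD /omega.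
by apply/eqP; rewrite eq_complex /=; apply/andP; split; apply/eqP; ring.
Qed.

Lemma norm_omega : `|omega R N| = 1.
Proof. by rewrite normc_def /= cos2Dsin2 sqrtr1. Qed.

Lemma norm_rchi a m : `|rchi a m| = 1.
Proof. by rewrite normrX norm_omega expr1n. Qed.

Lemma rchiDm a m m' : rchi a (m + m') = rchi a m * rchi a m'.
Proof. by rewrite /rchi mulnDr exprD. Qed.

Hypothesis N0 : (0 < N)%N.

Lemma omegaN : omega R N ^+ N = 1.
Proof.
have N0R : N%:R != 0 :> R by rewrite pnatr_eq0 -lt0n.
by rewrite omegaX mulrC divfK// mulr_natl cos2pi sin2pi.
Qed.

Lemma rchiD a b m : rchi (a + b) m = rchi a m * rchi b m.
Proof.
rewrite /rchi -exprD -mulnDl.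
(* Addition in [ZmodN N] reduces modulo [N.-1.+1]; the discarded multiple disappears because of this
   identity. *)
have w1 : omega R N ^+ N.-1.+1 = 1 by rewrite (prednK N0) omegaN.
rewrite [in RHS](divn_eq (a + b) N.-1.+1) mulnDl exprD.
by rewrite -mulnA mulnCA [X in _ = X * _]exprM w1 expr1n mul1r.
Qed.

(** For x = a pi/N, strictly between 0 and pi, the real part is cos(2x) = 1 - 2 sin(x)^2 < 1. *)
Lemma rchi1_neq1 a : a != 0 -> rchi a 1 != 1.
Proof.
move=> a0; have ap : (0 < a)%N by rewrite lt0n.
have aN : (a < N)%N by apply: leq_trans (ltn_ord a) _; rewrite prednK.
rewrite /rchi muln1 omegaX; apply/eqP => /(congr1 (@complex.Re R)) /=.
pose x : R := a%:R * pi / N%:R.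
have N0R : 0 < N%:R :> R by rewrite ltr0n.
have -> : a%:R * (2 * pi / N%:R) = x *+ 2 by rewrite /x; field; rewrite gt_eqF.
have x0 : 0 < x by rewrite divr_gt0// mulr_gt0 ?pi_gt0 ?ltr0n.
have xpi : x < pi by rewrite ltr_pdivrMr// mulrC ltr_pM2l ?pi_gt0// ltr_nat.
have s0 : 0 < sin x by apply: sin_gt0_pi; rewrite x0.
rewrite cos_mulr2n => c1; have := cos2Dsin2 x.
have : 0 < sin x ^+ 2 by rewrite exprn_gt0.
lra.
Qed.

(** Separates the largest index m_1 from the others, to follow the recursion of [trunc]. *)
Definition consf n (T : finType) (q : T * {ffun 'I_n -> T}) : {ffun 'I_n.+1 -> T} :=
  [ffun i => oapp q.2 q.1 (unlift ord0 i)].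

Lemma consf0 n T q : @consf n T q ord0 = q.1.
Proof. by rewrite ffunE unlift_none. Qed.

Lemma consfS n T q i : @consf n T q (lift ord0 i) = q.2 i.
Proof. by rewrite ffunE liftK. Qed.

Lemma consf_bij n T : bijective (@consf n T).
Proof.
exists (fun m : {ffun 'I_n.+1 -> T} => (m ord0, [ffun j : 'I_n => m (lift ord0 j)])).
  case=> x t; rewrite consf0; congr (_, _); apply/ffunP => j.
  by rewrite ffunE consfS.
move=> m; apply/ffunP => i.
by case: (unliftP ord0 i) => [j ->|->]; rewrite ?consfS ?consf0//= ffunE.
Qed.

Definition Lterm (B : nat) (ks : seq nat) (as_ : seq (ZmodN N))
    (m : {ffun 'I_(size ks) -> 'I_B}) : Cplx R :=
  omega R N ^+ (\sum_(j < size ks) nth 0%R as_ j * m j)%N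
      / \prod_(j < size ks) (m j)%:R ^+ nth 0%N ks j.

(** The strict bound M is kept apart from the codomain bound B: in the induction M becomes the
    previous index while the type of [m] keeps its B. *)
Definition decr_below (B M n : nat) (m : {ffun 'I_n -> 'I_B}) : bool :=
  [forall j, (0 < m j < M)%N] &&
  [forall i : 'I_n, forall j : 'I_n, (i < j)%N ==> (m j < m i)%N].

Lemma decr_below_cons B M n (q : 'I_B * {ffun 'I_n -> 'I_B}) :
  decr_below M (consf q) = (0 < q.1 < M)%N && decr_below q.1 q.2.
Proof.
apply/andP/andP => [[/forallP b /forallP d]|[hq /andP[/forallP b /forallP d]]].
  have b0 := b ord0; rewrite consf0 in b0; split=> //; apply/andP; split.
    apply/forallP => j; have := b (lift ord0 j); rewrite consfS => /andP[-> _] /=.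
    by have /forallP/(_ (lift ord0 j)) := d ord0; rewrite consf0 consfS.
  apply/forallP => i; apply/forallP => j; apply/implyP => ij.
  have /forallP/(_ (lift ord0 j)) := d (lift ord0 i); rewrite !consfS.
  by rewrite /= /bump /= !add1n ltnS ij.
split; apply/forallP => i; case: (unliftP ord0 i) => [i' ->|->].
- rewrite consfS; have /andP[-> /= h] := b i'; move/andP: hq => [_].
  exact: ltn_trans h.
- by rewrite consf0.
- apply/forallP => j; case: (unliftP ord0 j) => [j' ->|->]; last by rewrite ltn0.
  rewrite !consfS; apply/implyP; rewrite /= /bump /= !add1n ltnS => ij.
  by have /forallP/(_ j')/implyP := d i'; apply.
- apply/forallP => j; case: (unliftP ord0 j) => [j' ->|->]; last by rewrite ltnn.
  by rewrite consf0 consfS; apply/implyP => _; have /andP[] := b j'.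
Qed.

Lemma sum_decr_below B M ks (as_ : seq (ZmodN N)) : (M <= B)%N -> all (leq 1) ks ->
  \sum_(m : {ffun 'I_(size ks) -> 'I_B} | decr_below M m) Lterm as_ m =
  trunc rchi ks as_ M.
Proof.
elim: ks as_ M => [|k ks IH] as_ M MB /=.
  move=> _; rewrite (big_pred1 (ffun0 (card_ord 0))).
    by rewrite /Lterm /= !big_ord0 expr0 invr1 mulr1.
  move=> m; apply/andP/eqP => [_|_]; first by apply/ffunP => -[].
  by split; apply/forallP => -[].
move=> /andP[k0 pos].
rewrite (reindex (@consf (size ks) 'I_B)) /=; last exact/onW_bij/consf_bij.
under eq_bigl do rewrite decr_below_cons.
rewrite -(pair_big_dep (fun x : 'I_B => (0 < x < M)%N)
  (fun x (t : {ffun 'I_(size ks) -> 'I_B}) => decr_below x t)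
  (fun x t => @Lterm B (k :: ks) as_ (consf (x, t)))) /=.
rewrite (big_ord_widen B
  (fun m => rchi (head 0 as_) m / m%:R ^+ k * trunc rchi ks (behead as_) m) MB).
rewrite [RHS](bigID (fun x : 'I_B => 0 < x)%N) /=.
rewrite [X in _ = _ + X]big1 ?addr0; last first.
  move=> x /andP[_]; rewrite -eqn0Ngt => /eqP->.
  by rewrite expr0n gtn_eqF// invr0 mulr0 mul0r.
apply: eq_big => [x|x /andP[x0 xM]]; first by rewrite andbC.
rewrite -(IH (behead as_) x)//; last exact: ltnW.
rewrite big_distrr /=; apply: eq_bigr => t _; rewrite /Lterm /=.
rewrite !big_ord_recl !consf0 /= exprD nth0 invfM /rchi.
rewrite (eq_bigr (fun i : 'I_(size ks) => nth 0%R (behead as_) i * t i)%N);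
  last by move=> i _; rewrite consfS nth_behead.
have -> : \prod_(i < size ks) (consf (x, t) (lift ord0 i))%:R ^+ nth 0%N ks i =
    \prod_(i < size ks) (t i)%:R ^+ nth 0%N ks i :> Cplx R.
  by apply: eq_bigr => i _; rewrite consfS.
exact: mulrACA.
Qed.

Lemma Lstar_truncE ks (as_ : seq (ZmodN N)) : all (leq 1) ks ->
  Lstar_trunc R ks as_ = trunc rchi ks as_.
Proof.
move=> pos; apply/funext => M; rewrite -(sum_decr_below _ (leqnn M) pos).
apply: eq_bigl => m; rewrite /decr_below; congr (_ && _).
by apply: eq_forallb => j; rewrite ltn_ord andbT.
Qed.

End RootsOfUnity.

(** * Summation over all indices and passage to the limit *)

Lemma cvg_big_seq (R : realType) (I : eqType) (s : seq I) (P : pred I)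
    (u : I -> nat -> Cplx R) (l : I -> Cplx R) :
  (forall x, x \in s -> P x -> (u x @ \oo --> l x)%classic) ->
  ((fun M => \sum_(x <- s | P x) u x M) @ \oo --> \sum_(x <- s | P x) l x)%classic.
Proof.
elim: s => [|x s IH] ul.
  have -> : (fun M => \sum_(x <- [::] | P x) u x M) = fun=> 0.
    by apply/funext => M; rewrite big_nil.
  by rewrite big_nil; exact: cvg_cst.
have {}IH := IH (fun y ys => ul y (mem_behead (s := x :: s) ys)).
have -> : (fun M => \sum_(y <- x :: s | P y) u y M) = fun M =>
    if P x then u x M + \sum_(y <- s | P y) u y M
    else \sum_(y <- s | P y) u y M.
  by apply/funext => M; rewrite big_cons.
rewrite big_cons; case: (boolP (P x)) => [Px|_]; last exact: IH.
exact: (cvgD (ul x (mem_head x s) Px) IH).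
Qed.

Lemma dif_cat (V : zmodType) (b c : V) s1 s2 :
  dif b (s1 ++ c :: s2) = dif b (s1 ++ [:: c]) ++ dif c s2.
Proof. by elim: s1 b => [|d s1 IH] b //=; rewrite IH. Qed.

Section SumFormula.
Variables (R : realType) (N : nat).
Hypothesis N0 : (0 < N)%N.
Local Notation T := (trunc (@rchi R N)).
Implicit Types (a : ZmodN N) (ks : seq nat) (bs cs : seq (ZmodN N)).

(* The arguments of L_* after inserting the letter y_a behind the i-th y of a
   shuffle word, after inserting z_(1,a) behind the i-th z of the corresponding
   harmonic word, and after merging z_(1,a) with the (i+1)-st z. *)
Definition wins a bs i := dif 0 (take i bs ++ a :: drop i bs).
Definition zins a bs i := take i (dif 0 bs) ++ a :: drop i (dif 0 bs).
Definition zmerge a bs i :=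
  take i (dif 0 bs) ++ a + nth 0 (dif 0 bs) i :: drop i.+1 (dif 0 bs).

Lemma size_dif b bs : size (dif b bs) = size bs.
Proof. by elim: bs b => //= c bs IH b; rewrite IH. Qed.

Lemma trunc_cvg_Lstar ks cs : all (leq 1) ks -> (2 <= part ks 1)%N ->
  (T ks cs @ \oo --> Lstar R ks cs)%classic.
Proof.
move=> pos k2; rewrite /Lstar Lstar_truncE//.
case: ks pos k2 => // k ks /andP[_ pos] k2.
by apply: trunc_cvg => //; exact: norm_rchi.
Qed.

Lemma trunc_cvg_Lstar1 ks a cs : all (leq 1) ks ->
  (part ks 1 == 1)%N && (2 <= part ks 2)%N -> a != 0 ->
  (T ks (a :: cs) @ \oo --> Lstar R ks (a :: cs))%classic.
Proof.
move=> pos k12 a0; rewrite /Lstar Lstar_truncE//.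
case: ks pos k12 => [//|k1 [|k2 ks]]; first by rewrite andbF.
rewrite /part /= => /and3P[_ _ pos] /andP[/eqP -> k22].
apply: trunc_cvg1 => //.
- exact: rchiDm.
- exact: norm_rchi.
- exact: rchi1_neq1.
Qed.

Lemma calLB (u v : Aalg N) : calL R (u - v) = calL R u - calL R v.
Proof.
rewrite addrC -scaleN1r calL_linear.
by rewrite (rmorphN1 (ratr : {rmorphism rat -> Cplx R})) mulN1r addrC.
Qed.

(** For a != 0 both terms converge separately. For a = 0 they need not, but b - a = b makes the
    argument of [calL] zero. *)
Lemma calL_cvg ks a b cs : size ks = (size cs).+2 -> all (leq 1) ks ->
  (part ks 1 == 1)%N && (2 <= part ks 2)%N ->
  ((fun M => T ks [:: a, b & cs] M - T ks [:: a, b - a & cs] M) @ \oo -->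
    calL R (zprod ks [:: a, b & cs] - zprod ks [:: a, b - a & cs]))%classic.
Proof.
move=> sz pos k12; have [->|a0] := eqVneq a 0.
  rewrite subr0 calLB subrr (_ : (fun _ => _) = fun=> 0); first exact: cvg_cst.
  by apply/funext => M; rewrite subrr.
rewrite calLB !calL_zprod ?sz//.
by apply: cvgB; apply: trunc_cvg_Lstar1.
Qed.

Lemma word_relation a ks bs : all (leq 1) ks -> (2 <= part ks 1)%N ->
  size bs = size ks ->
  ((fun M => \sum_(p <- stuffle a ks (dif 0 bs)) T p.1 p.2 M
     - \sum_(p <- shuffle a ks bs) T p.1 (dif 0 p.2) M)
   @ \oo --> (0 : Cplx R))%classic.
Proof.
case: ks bs => // k ks [|b bs] // pos k2 [sz]; have /andP[_ pos'] := pos.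
have := double_shuffle_error (@rchiD R N N0) (@rchiDm R N) (@norm_rchi R N) a b k2 pos' sz.
apply: cvg_trans; apply: near_eq_cvg; apply: nearW => M.
rewrite (stuffleE (@rchiD R N N0)); last by rewrite size_dif /= sz.
congr (_ - _).
under [LHS]eq_bigr => m _ do (rewrite shuffleE//; last by rewrite /= sz).
have szk : size (b :: bs) = size (k :: ks) by rewrite /= sz.
rewrite exchange_big big_seq [RHS]big_seq; apply: eq_bigr => p.
move=> /(shuffle_wf pos szk)[p0 ppos psz].
by rewrite (trunc_pcoef (@rchiD R N N0) (@rchiDm R N)).
Qed.

(** At position 0 the condition on W reads k_1 + k_2 - 1 >= 2, which means k_1 >= 2, or k_1 = 1 and
    k_2 >= 2: hence two sums. Behind the last y only the single letter y_a can be added, hence the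
    last entry 1. *)
Lemma sum_shuffle_comp m K a bs M : size bs = m.+1 ->
  \sum_(ks <- compositions m.+1 K | (2 <= part ks 1)%N)
    \sum_(p <- shuffle a ks bs) T p.1 (dif 0 p.2) M =
  \sum_(ks <- compositions m.+2 K.+1 | (2 <= part ks 1)%N) T ks (wins a bs 0) M
  + \sum_(ks <- compositions m.+2 K.+1 | (part ks 1 == 1)%N && (2 <= part ks 2)%N)
      T ks (wins a bs 0) M
  + \sum_(1 <= i < m.+1)
      \sum_(ks <- compositions m.+2 K.+1 | (2 <= part ks 1)%N) T ks (wins a bs i) M
  + \sum_(ks <- compositions m.+2 K.+1 |
      (2 <= part ks 1)%N && (part ks m.+2 == 1)%N) T ks (wins a bs m.+1) M.
Proof.
move=> szb.
transitivity (\sum_(0 <= i < m.+1) \sum_(ks <- compositions m.+1 K | (2 <= part ks 1)%N)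
      \sum_(p <- iota 0 (nth 0%N ks i))
         T (take i ks ++ [:: p.+1, (nth 0%N ks i - p)%N & drop i.+1 ks]) (wins a bs i) M
    + \sum_(ks <- compositions m.+1 K | (2 <= part ks 1)%N)
        T (take m.+1 ks ++ 1%N :: drop m.+1 ks) (wins a bs m.+1) M).
  rewrite exchange_big -big_split big_seq_cond [RHS]big_seq_cond.
  apply: eq_bigr => ks /andP[/size_composition szk _].
  rewrite big_shuffle ?szb// szk; congr (_ + _).
  by rewrite /wins !take_oversize ?drop_oversize ?szk ?szb.
rewrite (big_comp_insert K
  (fun ks => (2 <= part ks 1)%N)
    (fun ks => T ks (wins a bs m.+1) M) (leqnn m.+1)); congr (_ + _); last first.
  rewrite big_seq_cond [RHS]big_seq_cond; apply: eq_bigl => ks.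
  case: (boolP (ks \in _)) => //= /size_composition szk.
  by rewrite andbC /part /=; case: ks szk.
rewrite big_nat_recl//=; congr (_ + _); last first.
  rewrite big_add1 /=; apply: eq_big_nat => i /andP[_ im].
  rewrite (big_comp_split K
    (fun ks => (2 <= part ks 1)%N)
    (fun ks => T ks (wins a bs i.+1) M) (im : (i.+1 < m.+1)%N)).
  by apply: eq_bigl => -[].
rewrite (big_comp_split K
  (fun ks => (2 <= part ks 1)%N)
    (fun ks => T ks (wins a bs 0) M) (ltn0Sn m)) (bigID (fun ks => 2 <= part ks 1)%N) /=.
congr (_ + _); rewrite big_seq_cond [RHS]big_seq_cond; apply: eq_bigl => ks;
  rewrite mem_compositions; case: ks => [|k1 [|k2 ks]]//; rewrite /part /=; lia.
Qed.

(** Inserting z_(1,a) in front pushes the condition on W to k_2; merging it into the first entry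
    raises that entry to at least 3, and merging it elsewhere leaves an entry at least 2 there. *)
Lemma sum_stuffle_comp m K a bs M : size bs = m.+1 ->
  \sum_(ks <- compositions m.+1 K | (2 <= part ks 1)%N)
    \sum_(p <- stuffle a ks (dif 0 bs)) T p.1 p.2 M =
  \sum_(ks <- compositions m.+2 K.+1 | (part ks 1 == 1)%N && (2 <= part ks 2)%N)
      T ks (zins a bs 0) M
  + \sum_(1 <= i < m.+2)
      \sum_(ks <- compositions m.+2 K.+1 | (2 <= part ks 1)%N && (part ks i.+1 == 1)%N)
        T ks (zins a bs i) M
  + \sum_(ks <- compositions m.+1 K.+1 | (3 <= part ks 1)%N) T ks (zmerge a bs 0) M
  + \sum_(1 <= i < m.+1)
      \sum_(ks <- compositions m.+1 K.+1 | (2 <= part ks 1)%N && (2 <= part ks i.+1)%N)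
        T ks (zmerge a bs i) M.
Proof.
move=> szb.
transitivity (\sum_(0 <= i < m.+2) \sum_(ks <- compositions m.+1 K | (2 <= part ks 1)%N)
      T (take i ks ++ 1%N :: drop i ks) (zins a bs i) M
    + \sum_(0 <= i < m.+1) \sum_(ks <- compositions m.+1 K | (2 <= part ks 1)%N)
      T (take i ks ++ (nth 0%N ks i).+1 :: drop i.+1 ks) (zmerge a bs i) M).
  rewrite exchange_big [X in _ = _ + X]exchange_big -big_split.
  rewrite big_seq_cond [RHS]big_seq_cond.
  apply: eq_bigr => ks /andP[/size_composition szk _].
  by rewrite big_stuffle ?size_dif ?szb// szk.
rewrite -addrA; congr (_ + _); rewrite [LHS]big_nat_recl//=; congr (_ + _).
- rewrite (big_comp_insert K
    (fun ks => (2 <= part ks 1)%N)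
    (fun ks => T ks (zins a bs 0) M) (leq0n m.+1)); by apply: eq_bigl => -[|k1 [|k2 ks]]; rewrite /part /= ?drop0.
- rewrite big_add1 /=; apply: eq_big_nat => i /andP[_ im].
  rewrite (big_comp_insert K
    (fun ks => (2 <= part ks 1)%N)
    (fun ks => T ks (zins a bs i.+1) M) im); apply: eq_bigl => -[|k1 ks]//=.
  by rewrite andbC.
- rewrite (big_comp_incr K
    (fun ks => (2 <= part ks 1)%N)
    (fun ks => T ks (zmerge a bs 0) M) (ltn0Sn m)); apply: eq_bigl => -[|k1 ks]//; rewrite /part /=; lia.
- rewrite big_add1 /=; apply: eq_big_nat => i /andP[_ im].
  rewrite (big_comp_incr K
    (fun ks => (2 <= part ks 1)%N)
    (fun ks => T ks (zmerge a bs i.+1) M) (im : (i.+1 < m.+1)%N)).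
  by apply: eq_bigl => -[|k1 ks]//=; rewrite andbC.
Qed.

Lemma sum_formula m K a b bs : size bs = m ->
  \sum_(ks <- compositions m.+2 K.+1 | (2 <= part ks 1)%N)
    Lstar R ks (wins a (b :: bs) 0)
  + \sum_(1 <= i < m.+1) \sum_(ks <- compositions m.+2 K.+1 | (2 <= part ks 1)%N)
      Lstar R ks (wins a (b :: bs) i)
  + \sum_(ks <- compositions m.+2 K.+1 |
      (2 <= part ks 1)%N && (part ks m.+2 == 1)%N) Lstar R ks (wins a (b :: bs) m.+1)
  =
  \sum_(ks <- compositions m.+2 K.+1 | (part ks 1 == 1)%N && (2 <= part ks 2)%N)
     calL R (zprod ks (zins a (b :: bs) 0) - zprod ks (wins a (b :: bs) 0))
  + \sum_(1 <= i < m.+2)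
      \sum_(ks <- compositions m.+2 K.+1 | (2 <= part ks 1)%N && (part ks i.+1 == 1)%N)
        Lstar R ks (zins a (b :: bs) i)
  + \sum_(ks <- compositions m.+1 K.+1 | (3 <= part ks 1)%N)
      Lstar R ks (zmerge a (b :: bs) 0)
  + \sum_(1 <= i < m.+1)
      \sum_(ks <- compositions m.+1 K.+1 | (2 <= part ks 1)%N && (2 <= part ks i.+1)%N)
        Lstar R ks (zmerge a (b :: bs) i).
Proof.
move=> szb; have szbb : size (b :: bs) = m.+1 by rewrite /= szb.
set LHS := (X in X = _); set RHS := (X in _ = X).
have comp_pos n K' ks : ks \in compositions n K' -> all (leq 1) ks.
  by rewrite mem_compositions => /and3P[].
pose LM M := \sum_(ks <- compositions m.+2 K.+1 | (2 <= part ks 1)%N)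
    T ks (wins a (b :: bs) 0) M
  + \sum_(1 <= i < m.+1) \sum_(ks <- compositions m.+2 K.+1 | (2 <= part ks 1)%N)
      T ks (wins a (b :: bs) i) M
  + \sum_(ks <- compositions m.+2 K.+1 |
      (2 <= part ks 1)%N && (part ks m.+2 == 1)%N) T ks (wins a (b :: bs) m.+1) M.
(* The shuffle words with k_1 = 1 are put here with a minus sign, paired with the harmonic words
   that start with z_(1,a), so that every summand has a limit even for a = 0. *)
pose RM M := \sum_(ks <- compositions m.+2 K.+1 |
      (part ks 1 == 1)%N && (2 <= part ks 2)%N)
     (T ks (zins a (b :: bs) 0) M - T ks (wins a (b :: bs) 0) M)
  + \sum_(1 <= i < m.+2)
      \sum_(ks <- compositions m.+2 K.+1 | (2 <= part ks 1)%N && (part ks i.+1 == 1)%N)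
        T ks (zins a (b :: bs) i) M
  + \sum_(ks <- compositions m.+1 K.+1 | (3 <= part ks 1)%N)
      T ks (zmerge a (b :: bs) 0) M
  + \sum_(1 <= i < m.+1)
      \sum_(ks <- compositions m.+1 K.+1 | (2 <= part ks 1)%N && (2 <= part ks i.+1)%N)
        T ks (zmerge a (b :: bs) i) M.
have LM_cvg : (LM @ \oo --> LHS)%classic.
  apply: cvgD; first apply: cvgD.
  - by apply: cvg_big_seq => ks /comp_pos pos k2; exact: trunc_cvg_Lstar.
  - apply: cvg_big_seq => i _ _.
    by apply: cvg_big_seq => ks /comp_pos pos k2; exact: trunc_cvg_Lstar.
  - by apply: cvg_big_seq => ks /comp_pos pos /andP[k2 _]; exact: trunc_cvg_Lstar.
have RM_cvg : (RM @ \oo --> RHS)%classic.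
  apply: cvgD; first apply: cvgD; first apply: cvgD.
  - apply: cvg_big_seq => ks ksc k12; rewrite /zins /wins /= !subr0.
    by apply: calL_cvg (comp_pos _ _ _ ksc) k12; rewrite (size_composition ksc) size_dif szb.
  - apply: cvg_big_seq => i _ _.
    by apply: cvg_big_seq => ks /comp_pos pos /andP[k2 _]; exact: trunc_cvg_Lstar.
  - by apply: cvg_big_seq => ks /comp_pos pos k3; apply: trunc_cvg_Lstar => //; exact: ltnW.
  - apply: cvg_big_seq => i _ _.
    by apply: cvg_big_seq => ks /comp_pos pos /andP[k2 _]; exact: trunc_cvg_Lstar.
have D0 : ((fun M => RM M - LM M) @ \oo --> (0 : Cplx R))%classic.
  (* With that pairing, the difference is exactly all harmonic words minus all shuffle words,
     grouped by W. *)
  have -> : (fun M => RM M - LM M) = fun M =>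
      \sum_(ks <- compositions m.+1 K | (2 <= part ks 1)%N)
        (\sum_(p <- stuffle a ks (dif 0 (b :: bs))) T p.1 p.2 M
         - \sum_(p <- shuffle a ks (b :: bs)) T p.1 (dif 0 p.2) M).
    apply/funext => M; rewrite sumrB sum_shuffle_comp// sum_stuffle_comp//.
    rewrite /LM /RM sumrB; ring.
  have h := @cvg_big_seq R _ (compositions m.+1 K) (fun ks => 2 <= part ks 1)%N
    (fun ks M => \sum_(p <- stuffle a ks (dif 0 (b :: bs))) T p.1 p.2 M
         - \sum_(p <- shuffle a ks (b :: bs)) T p.1 (dif 0 p.2) M) (fun=> 0).
  rewrite big1_eq in h; apply: h => ks ksc k2.
  apply: word_relation (comp_pos _ _ _ ksc) k2 _.
  by rewrite (size_composition ksc).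
apply/esym/eqP; rewrite -subr_eq0; apply/eqP.
by apply: (cvg_unique _ (cvgB RM_cvg LM_cvg) D0).
Qed.

End SumFormula.

(** * Identification with the index lists of the theorem *)

Section Diffs.
Variables (V : zmodType) (al : nat -> V).

Lemma dif_diffs p q :
  dif (al p) [seq al j | j <- index_iota p.+1 q.+1] = diffs al p.+1 q.
Proof.
rewrite /diffs /index_iota subSS; move: (q - p)%N => d.
by elim: d p => //= d IH p; rewrite IH.
Qed.

Lemma dif_diffs_rcons p q c : (p <= q)%N ->
  dif (al p) ([seq al j | j <- index_iota p.+1 q.+1] ++ [:: c]) =
  diffs al p.+1 q ++ [:: c - al q].
Proof.
move=> /subnKC <-; rewrite /diffs /index_iota -addSn addKn.
move: (q - p)%N => d; elim: d p => [|d IH] p /=; first by rewrite addn0.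
by rewrite IH addSnnS.
Qed.

Lemma take_diffs i q : (i <= q)%N -> take i (diffs al 1 q) = diffs al 1 i.
Proof.
move=> iq; rewrite /diffs /index_iota !subSS !subn0 -map_take take_iota.
by rewrite (minn_idPl iq).
Qed.

Lemma drop_diffs i q : drop i (diffs al 1 q) = diffs al i.+1 q.
Proof. by rewrite /diffs /index_iota -map_drop drop_iota !subSS subn0 add1n. Qed.

Lemma nth_diffs i q : (i < q)%N -> nth 0 (diffs al 1 q) i = al i.+1 - al i.
Proof.
move=> iq; rewrite /diffs (nth_map 0%N) /index_iota ?size_iota ?subSS ?subn0//.
by rewrite nth_iota.
Qed.

End Diffs.

Theorem theorem4p3 (R : realType) (N k n : nat) (hN : (1 <= N)%N)
    (hk : (n + 1 <= k)%N) (hn : (2 <= n)%N)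
    (a : ZmodN N) (a_ : (n.-1).-tuple (ZmodN N)) :
  (* al j is a_j for 1 <= j <= n - 1, and al 0 = 0 *)
  let al : nat -> ZmodN N := nth 0 (0 :: a_) in
  \sum_(ks <- compositions n k | (2 <= part ks 1)%N)
      Lstar R ks ([:: a; al 1%N - a] ++ diffs al 2 n.-1)
  + \sum_(2 <= i < n) \sum_(ks <- compositions n k | (2 <= part ks 1)%N)
      Lstar R ks (diffs al 1 i.-1 ++ [:: a - al i.-1; al i - a]
                  ++ diffs al i.+1 n.-1)
  + \sum_(ks <- compositions n k | (2 <= part ks 1)%N && (part ks n == 1%N))
      Lstar R ks (diffs al 1 n.-1 ++ [:: a - al n.-1])
  =
  \sum_(ks <- compositions n k | (part ks 1 == 1%N) && (2 <= part ks 2)%N)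
      calL R (zprod ks ([:: a; al 1%N] ++ diffs al 2 n.-1)
              - zprod ks ([:: a; al 1%N - a] ++ diffs al 2 n.-1))
  + \sum_(2 <= i < n.+1)
      \sum_(ks <- compositions n k | (2 <= part ks 1)%N && (part ks i == 1%N))
        Lstar R ks (diffs al 1 i.-1 ++ [:: a] ++ diffs al i n.-1)
  + \sum_(ks <- compositions n.-1 k | (3 <= part ks 1)%N)
      Lstar R ks ([:: a + al 1%N] ++ diffs al 2 n.-1)
  + \sum_(2 <= i < n)
      \sum_(ks <- compositions n.-1 k | (2 <= part ks 1)%N && (2 <= part ks i)%N)
        Lstar R ks (diffs al 1 i.-1 ++ [:: a + al i - al i.-1]
                    ++ diffs al i.+1 n.-1).
Proof.
case: n hn hk a_ => [|[|m]] // _ hk a_; case: k hk => // K _ al; rewrite [m.+2.-1]/=.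
have sza : size a_ = m.+1 by rewrite size_tuple.
have aE : a_ = [seq al j | j <- index_iota 1 m.+2] :> seq _.
  apply: (@eq_from_nth _ 0); first by rewrite size_map size_iota sza.
  move=> i; rewrite sza => im; rewrite (nth_map 0%N) ?size_iota//.
  by rewrite /index_iota subSS subn0 nth_iota.
have takeE i : (i <= m.+1)%N -> take i a_ = [seq al j | j <- index_iota 1 i.+1].
  move=> im; rewrite aE /index_iota !subSS !subn0 -map_take take_iota.
  by rewrite (minn_idPl im).
have dropE i : drop i a_ = [seq al j | j <- index_iota i.+1 m.+2].
  by rewrite aE /index_iota -map_drop drop_iota !subSS subn0 add1n.
have difE : dif 0 a_ = diffs al 1 m.+1 by rewrite aE -(dif_diffs al 0).
(* Here i counts the letters before the inserted one, so it is one less than the i of the theorem;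
   [al 0] = 0 covers i = 0. *)
have wE i : (i <= m)%N -> wins a a_ i =
    diffs al 1 i ++ [:: a - al i; al i.+1 - a] ++ diffs al i.+2 m.+1.
  move=> im; rewrite /wins dif_cat takeE; last exact: leqW.
  rewrite (dif_diffs_rcons al a (leq0n i)) -catA dropE /index_iota subSS subSn//=.
  by rewrite -(dif_diffs al i.+1) /index_iota subSS.
have wlast : wins a a_ m.+1 = diffs al 1 m.+1 ++ [:: a - al m.+1].
  by rewrite /wins drop_oversize ?sza// takeE// (dif_diffs_rcons al a (leq0n _)).
have zE i : (i <= m.+1)%N -> zins a a_ i = diffs al 1 i ++ [:: a] ++ diffs al i.+1 m.+1.
  by move=> im; rewrite /zins difE take_diffs// drop_diffs.
have mE i : (i <= m)%N -> zmerge a a_ i =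
    diffs al 1 i ++ [:: a + al i.+1 - al i] ++ diffs al i.+2 m.+1.
  by move=> im; rewrite /zmerge difE take_diffs ?drop_diffs ?nth_diffs ?addrA// leqW.
have w0 : wins a a_ 0 = [:: a; al 1%N - a] ++ diffs al 2 m.+1.
  by rewrite wE// /diffs /= subr0.
have z0 : zins a a_ 0 = [:: a; al 1%N] ++ diffs al 2 m.+1.
  by rewrite zE// /diffs /index_iota !subSS !subn0 /= subr0.
have m0 : zmerge a a_ 0 = [:: a + al 1%N] ++ diffs al 2 m.+1.
  by rewrite mE// /diffs /= subr0.
have [b [bs [abs szb]]] : exists b bs, a_ = b :: bs :> seq _ /\ size bs = m.
  by case: (tval a_) sza => // b bs [szb]; exists b, bs.
have E := sum_formula R hN K a b szb; rewrite -abs in E.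
rewrite -w0 -z0 -m0 -wlast.
etransitivity; last (etransitivity; first exact: E).
(* The shift by one reconciles the two numberings of positions. *)
- congr (_ + _ + _); rewrite [LHS]big_add1; apply: eq_big_nat => i /andP[_ im].
  by rewrite wE.
- congr (_ + _ + _ + _); rewrite [RHS]big_add1; apply: eq_big_nat => i /andP[_ im].
    by rewrite zE.
  by rewrite mE.
Qed.
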